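(* Fix an integer $s\geq 0$. Let $P=\operatorname{conv}\{x_1,\ldots,x_m\}\subset\mathbb{R}^d$ be a $d$-dimensional polytope each of whose facets is a simplicial polytope, with $x_k=(x_{k,1},\ldots,x_{k,d})$, and let $\mathcal{L}_k:=1-x_{k,1}t_1-\cdots-x_{k,d}t_d$ for $k=1,\ldots,m$. Then, as formal power series in $t_1,\ldots,t_d$ with coefficients in rank-$s$ tensors (the right sides expanded around $t=0$), $$\sum_{r\geq 0}\frac{(r+d-1)!}{(d-1)!}\Phi_{d-1}^{r,s}(P)(\mathbf{t})=\frac{1}{s!\,\omega_{1+s}}\sum_{F\in\mathcal{F}_{d-1}(P)}\frac{V_{d-1}(F)\operatorname{Ad}_F(t_1,\ldots,t_d)\,u_F^{s}}{\prod_{k\in F}\mathcal{L}_k}=\frac{1}{s!\,\omega_{1+s}}\,\frac{\sum_{F\in\mathcal{F}_{d-1}(P)}V_{d-1}(F)\operatorname{Ad}_F(t_1,\ldots,t_d)\,u_F^{s}\prod_{k\notin F}\mathcal{L}_k}{\prod_{k=1}^m\mathcal{L}_k}.$$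
   Context: $\mathcal{F}_{d-1}(P)$ is the set of facets of $P$; a facet $F$ is identified with the set of indices $k$ with $x_k\in F$. $V_{d-1}$ is $(d-1)$-dimensional volume (Hausdorff measure $\mathcal{H}^{d-1}$), $u_F$ is the outer unit normal of $F$ and $u_F^{s}=u_F^{\otimes s}$. $\omega_j=2\pi^{j/2}/\Gamma(j/2)$ is the surface area of the unit sphere in $\mathbb{R}^j$ (so $\omega_1=2$). The Minkowski surface tensors of $P$ are $\Phi_{d-1}^{r,s}(P)=\frac{1}{r!\,s!\,\omega_{1+s}}\sum_{F\in\mathcal{F}_{d-1}(P)}\Big(\int_F x^{\otimes r}\,\mathcal{H}^{d-1}(dx)\Big)\otimes u_F^{\otimes s}$, and $\Phi_{d-1}^{r,s}(P)(\mathbf{t})$ is obtained by replacing $x^{\otimes r}$ by $(x_1t_1+\cdots+x_dt_d)^r$, i.e. $\Phi_{d-1}^{r,s}(P)(\mathbf{t})=\frac{1}{r!\,s!\,\omega_{1+s}}\sum_F\Big(\int_F (x\cdot t)^r\,\mathcal{H}^{d-1}(dx)\Big)u_F^{\otimes s}$. For a facet $F$ (a $(d-1)$-dimensional simplicial polytope), the adjoint is $\operatorname{Ad}_F(t)=\sum_{\sigma\in\Sigma_F}\frac{V_{d-1}(\sigma)}{V_{d-1}(F)}\prod_{k\in F,\,k\notin\sigma}\mathcal{L}_k$, where $\Sigma_F$ is a triangulation of $F$ with vertices among the vertices of $F$ (this polynomial is independent of the chosen triangulation; in particular $\operatorname{Ad}_F=1$ if $F$ is a simplex). *)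

(* Defs.v *)
From HB Require Import structures.
From mathcomp Require Import all_boot all_order all_algebra.
(* The notations of mpoly are incompatible with those of mathcomp-analysis. *)
From mathcomp Require mpoly.
Import -(notations) mpoly.
From mathcomp Require Import all_classical all_reals all_analysis.
From mathcomp Require Import zify.

Set Implicit Arguments.
Unset Strict Implicit.
Unset Printing Implicit Defensive.
Import Order.TTheory GRing.Theory Num.Theory.
Import numFieldNormedType.Exports.

Local Open Scope classical_set_scope.
Local Open Scope ring_scope.

(* The norm that the library puts on 'rV[R]_d is the sup norm, hence the
   explicit Euclidean structure. *)
Definition dot (R : realType) (d : nat) (u v : 'rV[R]_d) : R :=
  \sum_(i < d) u 0 i * v 0 i.

Definition enorm (R : realType) (d : nat) (u : 'rV[R]_d) : R :=
  Num.sqrt (dot u u).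

Definition Gamma (R : realType) (z : R) : R :=
  \int[@lebesgue_measure R]_(t in `]0, +oo[) (t `^ (z - 1) * expR (- t)).

Definition omega (R : realType) (j : nat) : R :=
  2 * (pi `^ (j%:R / 2)) / Gamma (j%:R / 2).

(* Volume of the unit ball of R^k. *)
Definition kappa (R : realType) (k : nat) : R :=
  (pi `^ (k%:R / 2)) / Gamma (k%:R / 2 + 1).

Section Hausdorff.
Variables (R : realType) (d : nat).
Implicit Types A B : set 'rV[R]_d.

(* The diameter of the empty set is -oo. *)
Definition ediam A : \bar R :=
  ereal_sup [set (enorm (p.1 - p.2))%:E | p in A `*` A].

(* kappa_k (diam A / 2)^k; the convention for the empty set matters for k = 0
   only, where the weight of every nonempty set is 1. *)
Definition hweight (k : nat) A : \bar R :=
  if A == set0 then 0%E else (kappa R k * (fine (ediam A) / 2) ^+ k)%:E.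

Definition small_cover (delta : R) A : set ((set 'rV[R]_d)^nat) :=
  [set C | (forall i, (ediam (C i) <= delta%:E)%E) /\ A `<=` \bigcup_i C i].

Definition hausdorff_delta (k : nat) (delta : R) A : \bar R :=
  ereal_inf [set (\sum_(i <oo) hweight k (C i))%E | C in small_cover delta A].

Definition hausdorff (k : nat) A : \bar R :=
  ereal_sup [set hausdorff_delta k delta A | delta in [set delta | 0 < delta]].

Lemma Gamma_ge0 (z : R) : 0 <= Gamma z.
Proof.
by apply: Rintegral_ge0 => t _; rewrite mulr_ge0 ?powR_ge0 ?expR_ge0.
Qed.

Lemma kappa_ge0 (k : nat) : 0 <= kappa R k.
Proof. by rewrite divr_ge0 ?powR_ge0 ?Gamma_ge0. Qed.

Lemma fine_ediam_ge0 A : 0 <= fine (ediam A).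
Proof.
have [->|/set0P[y Ay]] := eqVneq A set0.
  by rewrite /ediam setX0 image_set0 ereal_sup0.
apply: fine_ge0; apply: (@le_trans _ _ (enorm (y - y))%:E).
  by rewrite lee_fin sqrtr_ge0.
by apply: ereal_sup_ubound; exists (y, y).
Qed.

Lemma hweight0 k : hweight k set0 = 0%E.
Proof. by rewrite /hweight eqxx. Qed.

Lemma hweight_ge0 k A : (0 <= hweight k A)%E.
Proof.
rewrite /hweight; case: ifP => // _; rewrite lee_fin mulr_ge0 ?kappa_ge0//.
by rewrite exprn_ge0// divr_ge0// fine_ediam_ge0.
Qed.

Lemma le_ediam A B : A `<=` B -> (ediam A <= ediam B)%E.
Proof.
move=> AB; apply: ereal_sup_le; apply: image_subset => -[y z] [/= Ay Az].
by split; exact: AB.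
Qed.

(* Subsets of diameter at most delta form a semiring of sets, so that
   hausdorff_delta is an instance of the library's mu_ext. *)
Definition small_type (delta : R) : Type := 'rV[R]_d.
HB.instance Definition _ delta := Pointed.on (small_type delta).

Definition small (delta : R) : set (set (small_type delta)) :=
  [set A | (ediam A <= delta%:E)%E].

Lemma small0 delta : @small delta set0.
Proof. by rewrite /small/= /ediam setX0 image_set0 ereal_sup0 leNye. Qed.

Lemma smallI delta : setI_closed (@small delta).
Proof.
by move=> A B sA _; apply: le_trans sA; apply: le_ediam; exact: subIsetl.
Qed.

Lemma smallD delta : semi_setD_closed (@small delta).
Proof.
move=> A B sA _; exists [set A `\` B]; split.
- exact: finite_set1.
- by move=> _ ->; apply: le_trans sA; apply: le_ediam; exact: subDsetl.
- by rewrite bigcup_set1.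
- by move=> _ _ -> ->.
Qed.

HB.instance Definition _ delta := @isSemiRingOfSets.Build default_measure_display
  (small_type delta) (@small delta) (@small0 delta) (@smallI delta)
  (@smallD delta).

Lemma hausdorff_deltaE k delta :
  hausdorff_delta k delta = mu_ext (hweight k : set (small_type delta) -> _).
Proof. by []. Qed.

Lemma hausdorff0 k : hausdorff k set0 = 0%E.
Proof.
rewrite /hausdorff.
rewrite (_ : [set _ | _ in _] = [set 0%E]) ?ereal_sup1//.
apply/seteqP; split=> [_ [delta _ <-]|_ ->] /=.
  by rewrite hausdorff_deltaE mu_ext0//; [exact: hweight0|exact: hweight_ge0].
exists 1 => //=.
by rewrite hausdorff_deltaE mu_ext0//; [exact: hweight0|exact: hweight_ge0].
Qed.

Lemma hausdorff_delta_le k delta A :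
  0 < delta -> (hausdorff_delta k delta A <= hausdorff k A)%E.
Proof. by move=> d0; apply: ereal_sup_ubound; exists delta. Qed.

Lemma hausdorff_ge0 k A : (0 <= hausdorff k A)%E.
Proof.
apply: le_trans (hausdorff_delta_le k A ltr01).
by rewrite hausdorff_deltaE; apply: mu_ext_ge0; exact: hweight_ge0.
Qed.

Lemma le_hausdorff k : {homo hausdorff k : A B / A `<=` B >-> (A <= B)%E}.
Proof.
move=> A B AB; apply: ge_ereal_sup => _ [delta d0 <-].
apply: le_trans (hausdorff_delta_le k B d0).
by rewrite hausdorff_deltaE; exact: le_mu_ext.
Qed.

Lemma hausdorff_sigma_subadditive k : sigma_subadditive (hausdorff k).
Proof.
move=> F; apply: ge_ereal_sup => _ [delta d0 <-].
have subadd := @mu_ext_sigma_subadditive _ (small_type delta) R (hweight k)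
  (hweight_ge0 k).
apply: (le_trans (subadd F)); apply: lee_nneseries => [i _ _|i _].
  by apply: mu_ext_ge0; exact: hweight_ge0.
exact: hausdorff_delta_le.
Qed.

HB.instance Definition _ (k : nat) :=
  isOuterMeasure.Build R 'rV[R]_d (hausdorff k) (hausdorff0 k)
    (hausdorff_ge0 k) (@le_hausdorff k) (@hausdorff_sigma_subadditive k).

Definition hausdorff_measure (k : nat) :
    {measure set (caratheodory_type (hausdorff k)) -> \bar R} :=
  (hausdorff k : {outer_measure set 'rV[R]_d -> \bar R}).

End Hausdorff.

(* Polytopes are given by a finite family x of points, and the convex hulls of
   subfamilies by sets of indices.  In particular a face of conv{x_k : k in S}
   is represented by the set of all indices k in S with x_k in that face. *)
Section Polytope.
Variables (R : realType) (d m : nat) (x : 'I_m -> 'rV[R]_d).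
Implicit Types S F G sigma tau : {set 'I_m}.

Definition hull S : set 'rV[R]_d :=
  [set y | exists w : 'I_m -> R, [/\ forall k, 0 <= w k,
     \sum_(k in S) w k = 1 & y = \sum_(k in S) w k *: x k]].

(* 1 + the dimension of the affine hull of {x_k : k in S}, i.e. the maximal
   number of affinely independent points; it is 0 if S is empty. *)
Definition arank S : nat :=
  \rank (\matrix_(k < m)
    (if k \in S then row_mx (1%:M : 'M[R]_1) (x k) else 0)).

Definition aff_indep S : Prop := arank S = #|S|.

Definition is_face S G : Prop := exists (a : 'rV[R]_d) (b : R),
  (forall y, hull S y -> dot a y <= b) /\
  G = finset (fun k => (k \in S) && (dot a (x k) == b)).

Definition is_facet S G : Prop := is_face S G /\ (arank G).+1 = arank S.

Definition is_vertex S (k : 'I_m) : Prop :=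
  exists G, [/\ is_face S G, k \in G & arank G = 1%N].

Definition is_simplex S : Prop :=
  exists sigma, [/\ sigma \subset S, aff_indep sigma & hull sigma = hull S].

Definition is_simplicial S : Prop :=
  forall G, is_facet S G -> is_simplex G.

(* Represented by its simplices of maximal dimension. *)
Definition is_triangulation S (T : {set {set 'I_m}}) : Prop :=
  [/\ forall sigma k, sigma \in T -> k \in sigma -> is_vertex S k,
      forall sigma, sigma \in T -> aff_indep sigma /\ arank sigma = arank S,
      hull S = \bigcup_(sigma in [set` T]) hull sigma &
      forall sigma tau, sigma \in T -> tau \in T ->
        hull sigma `&` hull tau = hull (sigma :&: tau)].

(* Facet of the polytope P spanned by all the x_k. *)
Definition facet F : bool := `[< is_facet [set: 'I_m]%SET F >].

(* Chosen among the unit vectors u such that F is the face of P where u is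
   maximal; it is unique if P is d-dimensional and F is a facet. *)
Definition outer_normal F : 'rV[R]_d :=
  get [set u | enorm u = 1 /\ exists b : R,
    (forall y, hull [set: 'I_m]%SET y -> dot u y <= b) /\
    F = finset (fun k => dot u (x k) == b)].

Definition vol S : R := fine (hausdorff d.-1 (hull S)).

Definition linform (y : 'rV[R]_d) : mpoly d R :=
  \sum_(i < d) y 0 i *: mpolyX R (mnm1 i).

Definition Lpoly (k : 'I_m) : mpoly d R := 1 - linform (x k).

Definition adjoint_poly (T : {set {set 'I_m}}) F : mpoly d R :=
  \sum_(sigma in T) (vol sigma / vol F) *: \prod_(k in F :\: sigma) Lpoly k.

End Polytope.

(* Rank-s tensors over A^d, by coordinates. *)
Notation tensor A d s := {ffun {ffun 'I_s -> 'I_d} -> A}.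

Definition tensor_pow (R : realType) (d s : nat) (u : 'rV[R]_d) :
    tensor R d s :=
  [ffun J : {ffun 'I_s -> 'I_d} => \prod_(j < s) u 0 (J j)].

Definition poly_tensor (R : realType) (n d s : nat) (p : mpoly n R)
    (t : tensor R d s) : tensor (mpoly n R) d s :=
  [ffun J : {ffun 'I_s -> 'I_d} => t J *: p].

(* Formal power series in n variables with coefficients in V. *)
Definition fps (n : nat) (V : Type) : Type := multinom n -> V.

(* f_0 + f_1 + ... = g for the coefficientwise discrete topology. *)
Definition fps_sums (n : nat) (V : nmodType) (f : nat -> fps n V)
    (g : fps n V) : Prop :=
  forall a : multinom n, exists N, forall M, (N <= M)%N ->
    \sum_(r < M) f r a = g a.

(* Expansion p * (1 + (1-q) + (1-q)^2 + ...) of p / q at the origin, for a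
   polynomial q with constant term 1; the terms (1-q)^j with j > |a| do not
   contribute to the coefficient of t^a. *)
Definition fps_frac (R : realType) (n : nat) (p q : mpoly n R) : fps n R :=
  fun a => mcoeff a (p * \sum_(j < (mdeg a).+1) (1 - q) ^+ j).

Definition fps_frac_tensor (R : realType) (n d s : nat)
    (p : tensor (mpoly n R) d s) (q : mpoly n R) : fps n (tensor R d s) :=
  fun a => [ffun J : {ffun 'I_s -> 'I_d} => fps_frac (p J) q a].

(* The polynomial Phi_{d-1}^{r,s}(P)(t), given by its coefficients: the
   coefficient of t^a is
     1 / (r! s! omega_{1+s}) sum_F (int_F [t^a] (y . t)^r H^{d-1}(dy)) u_F^s. *)
Definition Minkowski_poly (R : realType) (d m : nat) (x : 'I_m -> 'rV[R]_d)
    (r s : nat) : fps d (tensor R d s) :=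
  fun a => (r`!%:R * s`!%:R * omega R (1 + s))^-1 *:
    \sum_(F : {set 'I_m} | facet x F)
      (\int[hausdorff_measure R d d.-1]_(y in hull x F)
         mcoeff a (linform y ^+ r)) *: tensor_pow s (outer_normal x F).

Lemma mcoeff_mul_exp_eq0 (R : realType) (n : nat) (p r : mpoly n R) (j : nat)
    (a : multinom n) :
  mcoeff (@mnm0 n) r = 0 -> (mdeg a < j)%N -> mcoeff a (p * r ^+ j) = 0.
Proof.
move=> r0.
have exp0 i (b : multinom n) : (mdeg b < i)%N -> mcoeff b (r ^+ i) = 0.
  elim: i b => [//|i IHi] b bi.
  rewrite exprS mcoeffM big1// => -[/= u v] /eqP buv.
  have [/eqP|u0] := eqVneq (mdeg u) 0%N.
    by rewrite mdeg_eq0 => /eqP ->; rewrite r0 mul0r.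
  have ub : (mdeg u + mdeg v = mdeg b)%N by rewrite [in RHS]buv mdegD.
  by rewrite IHi ?mulr0//; move: u0 bi ub; clear; lia.
move=> aj; rewrite mcoeffM big1// => -[/= u v] /eqP auv.
have ua : (mdeg u + mdeg v = mdeg a)%N by rewrite [in RHS]auv mdegD.
by rewrite exp0 ?mulr0//; move: aj ua; clear; lia.
Qed.

(* fps_frac p q is the power series f such that q f = p. *)
Lemma fps_fracP (R : realType) (n : nat) (p q : mpoly n R) (a : multinom n) :
  mcoeff (@mnm0 n) q = 1 ->
  \sum_(k : bmultinom n (mdeg a).+1 * bmultinom n (mdeg a).+1 |
        a == mnm_add k.1 k.2) mcoeff k.1 q * fps_frac p q k.2 = mcoeff a p.
Proof.
move=> q1; have r0 : mcoeff (@mnm0 n) (1 - q) = 0.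
  by rewrite mcoeffB mcoeff1 eqxx q1 subrr.
pose S N := \sum_(j < N) (1 - q) ^+ j.
have SE N (b : multinom n) : (mdeg b < N)%N ->
    fps_frac p q b = mcoeff b (p * S N).
  move=> /subnKC <-; elim: (N - _)%N => [|i IHi]; first by rewrite addn0.
  rewrite addnS /S big_ord_recr/= mulrDr mcoeffD -IHi.
  by rewrite mcoeff_mul_exp_eq0 ?addr0// ltnS leq_addr.
have qS N : q * (p * S N) = p - p * (1 - q) ^+ N.
  have := subrX1 (1 - q) N; rewrite -/(S N) addrAC subrr add0r mulNr => E.
  by rewrite mulrCA -[q * _]opprK -E opprB mulrBr mulr1.
transitivity (mcoeff a (q * (p * S (mdeg a).+1))).
  rewrite mcoeffM; apply: eq_bigr => -[/= u v] /eqP auv.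
  have ua : (mdeg u + mdeg v = mdeg a)%N by rewrite [in RHS]auv mdegD.
  by rewrite (SE (mdeg a).+1)//; move: ua; clear; lia.
by rewrite qS mcoeffB mcoeff_mul_exp_eq0// subr0.
Qed.

(* Main.v *)
(* The only property of the Hausdorff measure H^n (n = d - 1) that matters, besides
   its being a Borel measure that is finite on n-simplices and zero on smaller ones,
   is its behaviour under homotheties: H^n(v + l (A - v)) = l^n H^n(A).
   Let S be an n-simplex with vertices v_k and barycentric coordinates b_k, and
   let f be a polynomial vanishing on the face opposite to v_k.  Shrinking S
   towards v_k and differentiating the scaling law of the integral of f at l = 1
   yields n int f + int E_k f = 0, with E_k the Euler field centred at v_k; the
   boundary term is absent because f vanishes there.  For f = b_k (y . t)^r this
   reads
     (n + 1 + r) int b_k (y.t)^r = int (y.t)^r + r (v_k.t) int b_k (y.t)^(r-1).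
   Let a be the series with terms (n+r)!/(n! r!) int (y.t)^r, and a_k the one with
   terms (n+r+1)!/(n! r!) int b_k (y.t)^r.  The recursion becomes
   a_k (1 - v_k.t) = a, and sum_k b_k = 1 becomes sum_k a_k = (n+1) a + theta a,
   with theta the Euler operator in t.  Hence theta kills a prod_k (1 - v_k.t),
   which is therefore the constant H^n(S).  Summing over the simplices of a
   triangulation gives the contribution of a facet. *)
Require Import Defs.
From HB Require Import structures.
From mathcomp Require Import all_boot all_order all_algebra.
From mathcomp Require mpoly.
Import -(notations) mpoly.
From mathcomp Require Import all_classical all_reals all_analysis.
From mathcomp Require Import measurable_realfun.
From mathcomp Require Import zify ring lra.

Set Implicit Arguments.
Unset Strict Implicit.
Unset Printing Implicit Defensive.
Import Order.TTheory GRing.Theory Num.Theory.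
Import numFieldNormedType.Exports.
Local Open Scope classical_set_scope.
Local Open Scope ring_scope.

(** * Power series quotients *)

Section TruncatedPolynomials.
Variables (R : realType) (n : nat).
Implicit Types p q r : mpoly n R.

(** Membership in the ideal of polynomials of order at least [N]. Identities of power series are
    treated as congruences modulo this ideal, so that all computations stay among polynomials. *)
Definition vanish_below N p : Prop :=
  forall a : multinom n, (mdeg a < N)%N -> mcoeff a p = 0.

Lemma vanish_belowM N p q : vanish_below N p -> vanish_below N (p * q).
Proof.
move=> p0 a aN; rewrite mcoeffM big1// => -[/= u v] /eqP auv.
rewrite p0 ?mul0r//; apply: leq_ltn_trans aN.
by rewrite [X in (_ <= mdeg X)%N]auv mdegD leq_addr.
Qed.

Lemma vanish_belowMr N p q : vanish_below N q -> vanish_below N (p * q).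
Proof. by rewrite mulrC; exact: vanish_belowM. Qed.

Lemma vanish_belowD N p q :
  vanish_below N p -> vanish_below N q -> vanish_below N (p + q).
Proof. by move=> p0 q0 a aN; rewrite mcoeffD p0// q0// addr0. Qed.

Lemma vanish_belowN N p : vanish_below N p -> vanish_below N (- p).
Proof. by move=> p0 a aN; rewrite mcoeffN p0// oppr0. Qed.

Lemma vanish_below_sum N I (s : seq I) (P : pred I) (F : I -> mpoly n R) :
  (forall i, P i -> vanish_below N (F i)) ->
  vanish_below N (\sum_(i <- s | P i) F i).
Proof.
move=> F0; elim/big_ind : _ => //; last by move=> p q; exact: vanish_belowD.
by move=> a _; rewrite mcoeff0.
Qed.

(* Truncation of 1 / q, for q with constant term 1. *)
Definition geom N q : mpoly n R := \sum_(j < N) (1 - q) ^+ j.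

(** The geometric sum telescopes: the difference is [- (1 - q) ^+ N], and [1 - q] has no constant
    term. *)
Lemma mul_geom N q : mcoeff (@mnm0 n) q = 1 -> vanish_below N (q * geom N q - 1).
Proof.
move=> q1; have E : q * geom N q - 1 = - (1 - q) ^+ N.
  have := subrX1 (1 - q) N; rewrite -/(geom N q) => E.
  rewrite -[X in _ - X](subrK ((1 - q) ^+ N)) -(opprB _ 1) E; ring.
move=> a aN; rewrite E -mulN1r mcoeff_mul_exp_eq0//.
by rewrite mcoeffB mcoeff1 eqxx q1 subrr.
Qed.

(** Uniqueness of the quotient: multiply the congruence by the truncated inverse of [q]. *)
Lemma fps_frac_eq p q f (a : multinom n) : mcoeff (@mnm0 n) q = 1 ->
  vanish_below (mdeg a).+1 (q * f - p) -> fps_frac p q a = mcoeff a f.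
Proof.
move=> q1 qf; apply/eqP; rewrite -subr_eq0 /fps_frac -mcoeffB; apply/eqP.
have gq := mul_geom (N := (mdeg a).+1) q1.
rewrite -/(geom _ _); set g := geom _ _ in gq *.
have -> : p * g - f = (q * g - 1) * f - (q * f - p) * g by ring.
suff /(_ a (ltnSn _)) : vanish_below (mdeg a).+1
  ((q * g - 1) * f - (q * f - p) * g) by [].
by apply: vanish_belowD; [|apply: vanish_belowN]; exact: vanish_belowM.
Qed.

Lemma fps_fracMr p q r (a : multinom n) :
  mcoeff (@mnm0 n) q = 1 -> mcoeff (@mnm0 n) r = 1 ->
  fps_frac (p * r) (q * r) a = fps_frac p q a.
Proof.
move=> q1 r1; apply: fps_frac_eq; first by rewrite rmorphM/= q1 r1 mulr1.
have -> : q * r * (p * geom (mdeg a).+1 q) - p * r =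
  p * r * (q * geom (mdeg a).+1 q - 1) by ring.
exact/vanish_belowMr/mul_geom.
Qed.

Lemma fps_frac_sum I (s : seq I) (P : pred I) (F : I -> mpoly n R) q
    (a : multinom n) :
  fps_frac (\sum_(i <- s | P i) F i) q a = \sum_(i <- s | P i) fps_frac (F i) q a.
Proof. by rewrite /fps_frac mulr_suml raddf_sum. Qed.

Lemma fps_fracZ c p q (a : multinom n) :
  fps_frac (c *: p) q a = c * fps_frac p q a.
Proof. by rewrite /fps_frac -scalerAl mcoeffZ. Qed.

(* q is the image of p under the Euler operator sum_i t_i d/dt_i. *)
Definition is_euler p q : Prop :=
  forall a : multinom n, mcoeff a q = (mdeg a)%:R * mcoeff a p.

Lemma is_eulerM p q p' q' :
  is_euler p p' -> is_euler q q' -> is_euler (p * q) (p' * q + p * q').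
Proof.
move=> pp' qq' a; rewrite mcoeffD !mcoeffM -big_split/= mulr_sumr.
apply: eq_bigr => -[/= u v] /eqP auv.
have/(congr1 (fun N => N%:R : R)) : mdeg a = (mdeg u + mdeg v)%N.
  by rewrite [in LHS]auv mdegD.
by rewrite natrD pp' qq' => uv; ring: uv.
Qed.

(** The hypothesis [is_euler p p] says that [p] is homogeneous of degree 1; the constant 1 is killed
    by the Euler operator. *)
Lemma is_euler1B p : is_euler p p -> is_euler (1 - p) (- p).
Proof.
move=> pp a; rewrite mcoeffN mcoeffB mcoeff1 mulrBr -pp.
by case: eqP => [->|_]; rewrite ?mdeg0 ?(mul0r, mulr0) sub0r.
Qed.

(** Logarithmic differentiation by induction on [s]: the Euler operator sends each factor [1 - X i]
    to [- X i]. *)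
Lemma is_euler_prod1B N (I : eqType) (s : seq I) (X : I -> mpoly n R) :
  (forall i, mcoeff (@mnm0 n) (X i) = 0) -> (forall i, is_euler (X i) (X i)) ->
  exists2 q, is_euler (\prod_(i <- s) (1 - X i)) q &
    vanish_below N (q + (\prod_(i <- s) (1 - X i)) *
                        \sum_(i <- s) X i * geom N (1 - X i)).
Proof.
move=> X0 XX; elim: s => [|i s [q qE q0]].
  exists 0; last by move=> a _; rewrite !big_nil mulr0 addr0 mcoeff0.
  by move=> a; rewrite big_nil mcoeff0 mcoeff1; case: eqP => [->|_];
    rewrite ?mdeg0 ?mul0r ?mulr0.
rewrite !big_cons; eexists; first exact: is_eulerM (is_euler1B (XX i)) qE.
set P := \prod_(_ <- s) _ in q0 *; set S := \sum_(_ <- s) _ in q0 *.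
set g := geom N (1 - X i).
have -> : - X i * P + (1 - X i) * q + (1 - X i) * P * (X i * g + S) =
  X i * P * ((1 - X i) * g - 1) + (1 - X i) * (q + P * S) by ring.
apply: vanish_belowD; apply: vanish_belowMr => //.
by apply: mul_geom; rewrite mcoeffB mcoeff1 eqxx X0 subr0.
Qed.

(* The Euler operator kills a * prod_i (1 - X_i), as seen from the logarithmic
   derivative sum_i X_i / (1 - X_i) = sum_i 1 / (1 - X_i) - |s|. *)
Lemma prod1B_log_derivative N (I : eqType) (s : seq I) (X b : I -> mpoly n R) a :
  (forall i, mcoeff (@mnm0 n) (X i) = 0) -> (forall i, is_euler (X i) (X i)) ->
  (forall i, i \in s -> vanish_below N (b i * (1 - X i) - a)) ->
  is_euler a (\sum_(i <- s) b i - (size s)%:R * a) ->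
  vanish_below N (a * (\prod_(i <- s) (1 - X i)) - mpolyC n (mcoeff (@mnm0 n) a)).
Proof.
move=> X0 XX ba aE; have [q qE q0] := is_euler_prod1B N s X0 XX.
set P := \prod_(_ <- s) _ in q0 qE *; set S := \sum_(_ <- s) _ in q0.
pose g i := geom N (1 - X i).
have g1 i : vanish_below N ((1 - X i) * g i - 1).
  by apply: mul_geom; rewrite mcoeffB mcoeff1 eqxx X0 subr0.
(* Modulo order [N], [b i] is a / (1 - X_i), hence [b i - a] is a X_i / (1 - X_i). *)
have bg : vanish_below N (\sum_(i <- s) b i - (size s)%:R * a - a * S).
  have -> : \sum_(i <- s) b i - (size s)%:R * a - a * S =
      \sum_(i <- s) (b i - a - a * (X i * g i)).
    rewrite !sumrB -mulr_sumr big_const_seq count_predT -/S.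
    by rewrite iter_addr_0 mulr_natl.
  rewrite big_seq; apply: vanish_below_sum => i si.
  have -> : b i - a - a * (X i * g i) =
    (b i * (1 - X i) - a) * g i + (a - b i) * ((1 - X i) * g i - 1) by ring.
  by apply: vanish_belowD; [apply: vanish_belowM|apply: vanish_belowMr]; auto.
(* By the Leibniz rule this is the image of [a * P] under the Euler operator. *)
have e0 : vanish_below N
    ((\sum_(i <- s) b i - (size s)%:R * a) * P + a * q).
  have -> : (\sum_(i <- s) b i - (size s)%:R * a) * P + a * q =
    (\sum_(i <- s) b i - (size s)%:R * a - a * S) * P + a * (q + P * S) by ring.
  by apply: vanish_belowD; [exact: vanish_belowM|exact: vanish_belowMr].
have P1 : mcoeff (@mnm0 n) P = 1.
  rewrite /P rmorph_prod/= big1// => i _.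
  by rewrite mcoeffB mcoeff1 eqxx X0 subr0.
move=> u uN; rewrite mcoeffB mcoeffC.
(* Away from the constant term, the Euler operator multiplies the coefficient by the nonzero scalar
   [mdeg u], so the coefficient itself is zero. *)
have [->|u0] := eqVneq u (@mnm0 n).
  by rewrite rmorphM/= P1 !mulr1 subrr.
have := is_eulerM aE qE u; rewrite e0// => /esym/eqP.
rewrite mulf_eq0 pnatr_eq0 mdeg_eq0 (negbTE u0)/= => /eqP ->.
by rewrite mulr0 subrr.
Qed.

End TruncatedPolynomials.

(** * Measurability for the Hausdorff measure *)

Section EuclideanNorm.
Variables (R : realType) (d : nat).
Implicit Types u v : 'rV[R]_d.

Lemma dotvv_ge0 u : 0 <= dot u u.
Proof. by apply: sumr_ge0 => i _; rewrite -expr2 sqr_ge0. Qed.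

Lemma enorm_ge0 u : 0 <= enorm u.
Proof. exact: sqrtr_ge0. Qed.

Lemma enormZ (c : R) u : enorm (c *: u) = `|c| * enorm u.
Proof.
rewrite /enorm -sqrtr_sqr -sqrtrM ?sqr_ge0//; congr Num.sqrt.
by rewrite /dot mulr_sumr; apply: eq_bigr => i _; rewrite !mxE; ring.
Qed.

Lemma ler_coord_enorm u i : `|u 0 i| <= enorm u.
Proof.
rewrite -sqrtr_sqr /enorm ler_sqrt ?dotvv_ge0// /dot (bigD1 i)//= expr2 lerDl.
by apply: sumr_ge0 => j _; rewrite -expr2 sqr_ge0.
Qed.

Lemma enorm_le_sum u : enorm u <= \sum_i `|u 0 i|.
Proof.
have s0 : 0 <= \sum_i `|u 0 i| by apply: sumr_ge0.
rewrite -[leRHS]ger0_norm// -sqrtr_sqr /enorm ler_sqrt ?sqr_ge0//.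
rewrite expr2 mulr_suml; apply: ler_sum => i _.
rewrite (le_trans (ler_norm _))// normrM ler_wpM2l// (bigD1 i)//= lerDl.
exact: sumr_ge0.
Qed.

End EuclideanNorm.

Section HausdorffMeasurability.
Variables (R : realType) (d k : nat).
Implicit Types (A B C : set 'rV[R]_d) (delta : R).
Local Notation H := (hausdorff k).

Lemma ediam_ge A y z : A y -> A z -> ((enorm (y - z))%:E <= ediam A)%E.
Proof. by move=> Ay Az; apply: ereal_sup_ubound; exists (y, z). Qed.

Lemma ediam_le A (c : R) : (forall y z, A y -> A z -> enorm (y - z) <= c) ->
  (ediam A <= c%:E)%E.
Proof.
by move=> Ac; apply: ge_ereal_sup => _ [[y z] [/= Ay Az] <-]; rewrite lee_fin Ac.
Qed.

(** The bound by [delta] keeps the diameters finite; [fine] sends an infinite diameter to 0, which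
    would break monotonicity. *)
Lemma le_hweight A B delta : A `<=` B -> (ediam B <= delta%:E)%E ->
  (hweight k A <= hweight k B)%E.
Proof.
move=> AB Bd; rewrite {1}/hweight.
have [_|/set0P[y Ay]] := eqVneq A set0; first exact: hweight_ge0.
have B0 : B == set0 = false by apply/negbTE/set0P; exists y; exact: AB.
have fin C : A `<=` C -> C `<=` B -> ediam C \is a fin_num.
  move=> AC CB; rewrite fin_real//; apply/andP; split.
    by apply: lt_le_trans (ediam_ge (AC _ Ay) (AC _ Ay)); rewrite ltNyr.
  by apply: le_lt_trans (le_trans (le_ediam CB) Bd) _; rewrite ltry.
rewrite /hweight B0 lee_fin ler_wpM2l ?kappa_ge0//.
rewrite lerXn2r ?nnegrE ?divr_ge0 ?fine_ediam_ge0//.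
by rewrite ler_pM2r// fine_le ?fin//; exact: le_ediam.
Qed.

Lemma hausdorff_delta_anti A (d1 d2 : R) : d1 <= d2 ->
  (hausdorff_delta k d2 A <= hausdorff_delta k d1 A)%E.
Proof.
move=> d12; apply: ereal_inf_le_tmp => _ [C [Cd AC] <-]; exists C => //.
by split=> // i; rewrite (le_trans (Cd i))// lee_fin.
Qed.

(** A covering set of diameter at most [delta < e] cannot meet both [A] and [B], so a cover of the
    union splits into covers of the two sets without increasing the total weight. *)
Lemma hausdorff_delta_separated A B (e delta : R) : delta < e ->
  (forall a b, A a -> B b -> e <= enorm (a - b)) ->
  (hausdorff_delta k delta A + hausdorff_delta k delta B <=
   hausdorff_delta k delta (A `|` B))%E.
Proof.
move=> de AB; apply: le_ereal_inf_tmp => _ [C [Cd ABC] <-].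
have sub (D : set 'rV[R]_d) i : (ediam (C i `&` D) <= delta%:E)%E.
  by apply: le_trans (Cd i); apply: le_ediam; exact: subIsetl.
apply: (@le_trans _ _ (\sum_(i <oo) hweight k (C i `&` A) +
                       \sum_(i <oo) hweight k (C i `&` B))%E).
  apply: leeD; apply: ereal_inf_lbound.
    exists (fun i => C i `&` A) => //; split=> // y Ay.
    by have [|i _ Ciy] := ABC y; [left|exists i].
  exists (fun i => C i `&` B) => //; split=> // y By.
  by have [|i _ Ciy] := ABC y; [right|exists i].
rewrite -nneseriesD; [|by move=> *; exact: hweight_ge0..].
apply: lee_nneseries => i *; first by rewrite adde_ge0// hweight_ge0.
have [->|/set0P[a [Ca Aa]]] := eqVneq (C i `&` A) set0.
  by rewrite hweight0 add0e; apply: le_hweight (Cd i); exact: subIsetl.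
have -> : C i `&` B = set0.
  apply/seteqP; split=> // b [Cb Bb]; have := AB a b Aa Bb.
  have := le_trans (ediam_ge Ca Cb) (Cd i); rewrite lee_fin => H1 H2.
  by have := le_lt_trans (le_trans H2 H1) de; rewrite ltxx.
by rewrite hweight0 adde0; apply: le_hweight (Cd i); exact: subIsetl.
Qed.

(** The metric outer measure property. The two suprema are approximated with a common [dl], fine
    enough for both sets and smaller than [e]. *)
Lemma hausdorff_separated A B (e : R) : 0 < e ->
  (forall a b, A a -> B b -> e <= enorm (a - b)) ->
  (H A + H B <= H (A `|` B))%E.
Proof.
move=> e0 AB; have [->|HAB] := eqVneq (H (A `|` B)) +oo%E; first exact: leey.
have fin C : C `<=` A `|` B -> H C \is a fin_num.
  move=> CAB; rewrite ge0_fin_numE ?hausdorff_ge0//.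
  by rewrite (le_lt_trans (le_hausdorff k CAB))// lt_neqAle HAB leey.
have HA := fin A (@subsetUl _ _ _); have HB := fin B (@subsetUr _ _ _).
apply/lee_addgt0Pr => _/posnumP[eps].
have [_ [d1 d10 <-] HA1] :=
  @ub_ereal_sup_adherent R _ (eps%:num / 2) ltac:(by []) HA.
have [_ [d2 d20 <-] HB1] :=
  @ub_ereal_sup_adherent R _ (eps%:num / 2) ltac:(by []) HB.
pose dl := Num.min (Num.min d1 d2) (e / 2).
have dl0 : 0 < dl by rewrite !lt_min d10 d20 divr_gt0.
have dle : dl < e.
  by apply: (@le_lt_trans _ _ (e / 2)); rewrite ?ge_min ?lexx ?orbT//; lra.
have := hausdorff_delta_separated dle AB.
move=> /le_trans/(_ (hausdorff_delta_le k _ dl0)) => sep.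
have H1 : (H A - (eps%:num / 2)%:E <= hausdorff_delta k dl A)%E.
  apply: le_trans (ltW HA1) (hausdorff_delta_anti _ _).
  by rewrite !ge_min lexx.
have H2 : (H B - (eps%:num / 2)%:E <= hausdorff_delta k dl B)%E.
  apply: le_trans (ltW HB1) (hausdorff_delta_anti _ _).
  by rewrite !ge_min lexx orbT.
have := le_trans (leeD H1 H2) sep.
move: HA HB => /fineK <- /fineK <-; rewrite -!EFinB -!EFinD.
rewrite -leeBlDr// -EFinB => /(le_trans _); apply.
by rewrite lee_fin; lra.
Qed.

Lemma hausdorff_separated_sum (A : (set 'rV[R]_d)^nat) (e : R^nat) N :
  (forall i, 0 < e i) ->
  (forall i j a b, (i < j)%N -> A i a -> A j b -> e j <= enorm (b - a)) ->
  (\sum_(i < N) H (A i) <= H (\big[setU/set0]_(i < N) A i))%E.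
Proof.
move=> e0 Ae; elim: N => [|N IHN]; first by rewrite !big_ord0 hausdorff_ge0.
rewrite !big_ord_recr/=; apply: le_trans (leeD2r _ IHN) _.
rewrite addeC setUC; apply: (@hausdorff_separated _ _ (e N)) => // b a ANb.
rewrite -bigcup_mkord => -[i /= iN Aia]; exact: Ae iN Aia ANb.
Qed.

Section LipschitzSublevel.
Variables (phi : 'rV[R]_d -> R) (L : R).
Hypothesis L_gt0 : 0 < L.
Hypothesis phiL : forall y z, `|phi y - phi z| <= L * enorm (y - z).
Variables (c : R) (X : set 'rV[R]_d).
Hypothesis HX : (H X < +oo)%E.

(* The set X where phi > c is exhausted by the far sets, at positive distance
   from the sublevel set, up to the union of the thin shells. *)
Let far i := [set y | X y /\ c + i.+1%:R^-1 <= phi y].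
Let shell i := far i.+1 `\` far i.

(** Two shells whose indices differ by at least 2 are separated, because the values of the Lipschitz
    function [phi] on them are. Hence the shells of one parity have total measure at most that of
    [X]. *)
Let shell_sum_le N : (\sum_(i < N) H (shell i.*2) <= H X)%E /\
  (\sum_(i < N) H (shell i.*2.+1) <= H X)%E.
Proof.
have XS (F : nat -> nat) :
    (H (\big[setU/set0]_(i < N) shell (F i)) <= H X)%E.
  apply: le_hausdorff; rewrite -(bigcup_mkord _ (fun i => shell (F i))).
    by move=> y [i _ [[]]].
(* The gap between consecutive thresholds, divided by the Lipschitz constant. *)
pose e j : R := L^-1 * (j.+1%:R^-1 - j.+2%:R^-1).
have e0 j : 0 < e j.
  rewrite mulr_gt0 ?invr_gt0// subr_gt0 ltf_pV2 ?posrE ?ltr0n//.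
  by rewrite ltr_nat.
have sep i j a b : (i.+1 < j)%N -> shell i a -> shell j b ->
    e j.-1 <= enorm (b - a).
  move=> ij [[Xa ai] _] [[Xb _] /not_andP[//|/negP]]; rewrite -ltNge => bj.
  rewrite -(ler_pM2l L_gt0) (le_trans _ (phiL b a))// distrC /e mulrA divff ?gt_eqF//.
  rewrite mul1r prednK ?(leq_trans _ ij)//.
  have : j%:R^-1 <= (i.+2%:R : R)^-1.
    by rewrite lef_pV2 ?posrE ?ltr0n ?ler_nat//; lia.
  have := ler_norm (phi a - phi b); move: ai bj.
  by move: (i.+2%:R^-1) (j.+1%:R^-1) (j%:R^-1) => u v w; lra.
split.
  apply: le_trans _ (XS double).
  apply: (@hausdorff_separated_sum (fun i => shell i.*2) (fun i => e i.*2.-1)) => //.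
  by move=> i j a b ij; apply: sep; lia.
apply: le_trans _ (XS (fun i => i.*2.+1)).
apply: (@hausdorff_separated_sum (fun i => shell i.*2.+1) (fun i => e i.*2)) => //.
by move=> i j a b ij; apply: sep; lia.
Qed.

(** The argument of Carathéodory's criterion: [far N] is separated from the sublevel set, and the
    part of {phi > c} that it misses is covered by a tail of the convergent series of shells. *)
Lemma hausdorff_split_sublevel :
  (H (X `&` [set y | phi y <= c]%R) + H (X `&` ~` [set y | phi y <= c]%R)
   <= H X)%E.
Proof.
set S := [set y | phi y <= c].
have sum_shell : (\sum_(0 <= i <oo) H (shell i) < +oo)%E.
  apply: (@le_lt_trans _ _ (H X + H X)%E); last first.
    by rewrite lte_add_pinfty.
  apply: lime_le; first by apply: is_cvg_nneseries => *; exact: hausdorff_ge0.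
  apply: nearW => N.
  have [S1 S2] := shell_sum_le N.
  apply: le_trans (leeD S1 S2).
  rewrite -big_split/= big_mkord.
  have -> : (\sum_(i < N) (H (shell i.*2) + H (shell i.*2.+1)) =
             \sum_(i < N.*2) H (shell i))%E.
    elim: N {S1 S2} => [|N IHN]; first by rewrite !big_ord0.
    by rewrite doubleS !big_ord_recr/= IHN -addeA.
  rewrite -!(big_mkord xpredT (fun i => H (shell i))).
  rewrite [leRHS](@big_cat_nat _ _ _ N) //=; last by rewrite -addnn leq_addr.
  by rewrite leeDl// sume_ge0// => i _; exact: hausdorff_ge0.
have bound N :
    (H (X `&` S) + H (X `&` ~` S) <= H X + \sum_(N <= i <oo) H (shell i))%E.
  have H1 : (H (X `&` S) + H (far N) <= H X)%E.
    apply: le_trans (@hausdorff_separated _ _ (L^-1 * N.+1%:R^-1) _ _) _.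
    - by rewrite mulr_gt0// invr_gt0.
    - move=> a b [Xa Sa] [Xb Nb]; rewrite /S/= in Sa.
      rewrite -(ler_pM2l L_gt0) mulrA divff ?gt_eqF// mul1r.
      rewrite (le_trans _ (phiL a b))// distrC.
      have := ler_norm (phi b - phi a); move: Nb Sa.
      by move: (N.+1%:R^-1) => u; lra.
    - by apply: le_hausdorff => y [[]|[]].
  apply: le_trans (leeD2r _ H1); rewrite -addeA leeD2l//.
  (* A point with [phi y > c] lies in some [far K]; if [N < K], descending from [K] reaches either
     [far N] or a shell of index at least [N]. *)
  have sub : X `&` ~` S `<=` far N `|` \bigcup_(i in ~` `I_N) shell i.
    move=> y [Xy /negP]; rewrite -ltNge => cy.
    have [K yK] : exists K, far K y.
      exists (Num.trunc (phi y - c)^-1); split=> //.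
      rewrite -lerBrDl -[leRHS]invrK lef_pV2 ?posrE ?invr_gt0 ?subr_gt0 ?ltr0n//.
      by rewrite ltW// truncnS_gt.
    have [NK|KN] := leqP N K; last first.
      left; split=> //; case: yK => _; apply: le_trans; rewrite lerD2l.
      by rewrite lef_pV2 ?posrE ?ltr0n// ler_nat ltnW.
    elim: K NK yK => [|K IHK NK yK].
      by rewrite leqn0 => /eqP -> ?; left.
    have [yK'|yK'] := pselect (far K y).
      have [NK'|] := leqP N K; first exact: IHK.
      by move=> KN; left; have -> : N = K.+1 by apply/eqP; rewrite eqn_leq NK.
    have [NK'|KN] := leqP N K.
      by right; exists K => //=; apply/negP; rewrite -leqNgt.
    by left; have -> : N = K.+1 by apply/eqP; rewrite eqn_leq NK.
  apply: le_trans (le_hausdorff k sub) _.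
  apply: le_trans (outer_measureU2 _ _ _) _; rewrite leeD2l//.
  exact: outer_measure_sigma_subadditive_tail.
have cvg0 := nneseries_tail_cvg sum_shell (fun i _ => hausdorff_ge0 k (shell i)).
rewrite -[leRHS]adde0.
have lim : (H X + \sum_(N <= i <oo) H (shell i))%E @[N --> \oo] --> (H X + 0)%E.
  by apply: cvgeD cvg0; [exact: fin_num_adde_defl|exact: cvg_cst].
by apply: (cvge_to_ge lim); apply: nearW.
Qed.

End LipschitzSublevel.

(** Sublevel sets satisfy the Carathéodory condition. The measurability of affine functions, and
    through them of simplices, rests on this. *)
Lemma measurable_fun_lipschitz (phi : 'rV[R]_d -> R) (L : R) :
  (forall y z, `|phi y - phi z| <= L * enorm (y - z)) ->
  measurable_fun [set: caratheodory_type (hausdorff k)] phi.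
Proof.
move=> phiL.
have L1 : 0 < Num.max L 1 by rewrite lt_max ltr01 orbT.
have phiL1 y z : `|phi y - phi z| <= Num.max L 1 * enorm (y - z).
  by apply: le_trans (phiL y z) _; rewrite ler_wpM2r ?enorm_ge0// le_max lexx.
move=> mT; apply: (measurability _ (RGenOInfty.measurableE R)) => //.
move=> /= _ [_ [c ->] <-]; rewrite setTI.
have -> : phi @^-1` `]c, +oo[ = ~` [set y | phi y <= c]%R.
  by apply/seteqP; split=> y /=; rewrite in_itv/= andbT ltNge => /negP.
apply: (@measurableC _ (caratheodory_type (hausdorff k))).
apply: le_caratheodory_measurable => X.
have [HX|HX] := eqVneq (hausdorff k X) +oo%E.
  by apply: le_trans (leey _) _; rewrite -HX.
by apply: (hausdorff_split_sublevel L1 phiL1); rewrite lt_neqAle HX leey.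
Qed.

End HausdorffMeasurability.

(** * Homotheties and convex hulls *)

Section HausdorffHomothety.
Variables (R : realType) (d k : nat).
Implicit Types (A B C : set 'rV[R]_d) (c y z : 'rV[R]_d) (l : R).

Definition homothety c l y : 'rV[R]_d := c + l *: (y - c).

Lemma homothetyK c l : l != 0 -> cancel (homothety c l) (homothety c l^-1).
Proof.
move=> l0 y; rewrite /homothety [c + _ - c]addrAC subrr add0r.
by rewrite scalerA mulVf// scale1r addrC subrK.
Qed.

Lemma homothetyVK c l : l != 0 -> cancel (homothety c l^-1) (homothety c l).
Proof. by move=> l0; rewrite -{2}(invrK l); apply: homothetyK; rewrite invr_eq0. Qed.

Lemma image_homothetyK c l A : l != 0 ->
  homothety c l^-1 @` (homothety c l @` A) = A.
Proof.
move=> l0; rewrite image_comp; apply/seteqP; split=> [_ [y Ay <-]|y Ay].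
  by rewrite /= homothetyK.
by exists y => //=; rewrite homothetyK.
Qed.

Lemma preimage_homothety c l A : l != 0 ->
  homothety c l @^-1` A = homothety c l^-1 @` A.
Proof.
move=> l0; apply/seteqP; split=> [y Ay|_ [y Ay <-]] /=.
  by exists (homothety c l y) => //; rewrite homothetyK.
by rewrite homothetyVK.
Qed.

Lemma enorm_homothetyB c l y z :
  enorm (homothety c l y - homothety c l z) = `|l| * enorm (y - z).
Proof.
rewrite -enormZ /homothety opprD addrACA subrr add0r -scalerBr opprB.
by rewrite addrA subrK.
Qed.

(** The image of a cover of mesh [delta / l] is a cover of mesh [delta], whose weights are
    multiplied by at most [l ^+ k]. *)
Lemma hausdorff_homothety_le c l A : 0 < l ->
  (hausdorff k (homothety c l @` A) <= (l ^+ k)%:E * hausdorff k A)%E.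
Proof.
move=> l0; have lk0 : 0 < l ^+ k by rewrite exprn_gt0.
apply: ge_ereal_sup => _ [delta delta0 <-].
have dl0 : 0 < delta / l by rewrite divr_gt0.
apply: (@le_trans _ _ ((l ^+ k)%:E * hausdorff_delta k (delta / l) A)%E); last first.
  by rewrite lee_pmul2l ?lte_fin// hausdorff_delta_le.
rewrite -lee_pdivrMl//; apply: le_ereal_inf_tmp => _ [C [Cd AC] <-].
rewrite lee_pdivrMl// -nneseriesZl; last by move=> *; exact: hweight_ge0.
have diam i : (ediam (homothety c l @` C i) <= l%:E * ediam (C i))%E.
  apply: ge_ereal_sup => _ [[_ _] [/= [y Cy <-] [z Cz <-]] <-].
  by rewrite enorm_homothetyB gtr0_norm// EFinM lee_pmul2l ?lte_fin// ediam_ge.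
apply: (@le_trans _ _ (\sum_(i <oo) hweight k (homothety c l @` C i))%E).
  apply: ereal_inf_lbound; exists (fun i => homothety c l @` C i) => //; split.
    move=> i; apply: le_trans (diam i) _; rewrite -lee_pdivlMl//.
    by apply: le_trans (Cd i) _; rewrite -EFinM lee_fin mulrC.
  by move=> _ [y Ay <-]; have [i _ Ciy] := AC y Ay; exists i => //; exists y.
apply: lee_nneseries => [i _ _|i _]; first exact: hweight_ge0.
have [->|/set0P[y Cy]] := eqVneq (C i) set0.
  by rewrite image_set0 hweight0 mule0.
have C0 : C i == set0 = false by apply/negbTE/set0P; exists y.
have hC0 : homothety c l @` C i == set0 = false.
  by apply/negbTE/set0P; exists (homothety c l y); exists y.
have finC : ediam (C i) \is a fin_num.
  rewrite fin_real//; apply/andP; split.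
    by apply: lt_le_trans (ediam_ge Cy Cy); rewrite ltNyr.
  by apply: le_lt_trans (Cd i) _; rewrite ltry.
rewrite /hweight C0 hC0 -EFinM lee_fin mulrCA ler_wpM2l ?kappa_ge0//.
rewrite -exprMn lerXn2r ?nnegrE ?mulr_ge0 ?divr_ge0 ?fine_ediam_ge0 ?(ltW l0)//.
rewrite mulrA ler_pM2r//; apply: le_trans (fine_le _ _ (diam i)) _.
- rewrite fin_real//; apply/andP; split.
    apply: lt_le_trans (@ediam_ge _ _ (_ @` C i) (homothety c l y) (homothety c l y) _ _).
    + by rewrite ltNyr.
    + by exists y.
    + by exists y.
  by apply: le_lt_trans (diam i) _; rewrite ltey_eq fin_numM.
- by rewrite fin_numM.
- by rewrite fineM.
Qed.

Lemma hausdorff_homothety c l A : 0 < l ->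
  hausdorff k (homothety c l @` A) = ((l ^+ k)%:E * hausdorff k A)%E.
Proof.
move=> l0; apply/eqP; rewrite eq_le hausdorff_homothety_le//=.
rewrite -lee_pdivlMl ?exprn_gt0// -exprVn -{1}(image_homothetyK c A (lt0r_neq0 l0)).
by apply: hausdorff_homothety_le; rewrite invr_gt0.
Qed.

(** A homothety multiplies the outer measure of every set by the same constant, so it transports the
    Carathéodory splitting condition. *)
Lemma measurable_homothety c l : 0 < l ->
  measurable_fun [set: caratheodory_type (@hausdorff R d k)]
    (homothety c l : _ -> caratheodory_type (@hausdorff R d k)).
Proof.
move=> l0 _ A mA; rewrite setTI.
change (caratheodory_measurable (@hausdorff R d k) A) in mA.
change (caratheodory_measurable (@hausdorff R d k) (homothety c l @^-1` A)) => X.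
have hI (Y Z : set 'rV[R]_d) : homothety c l^-1 @` (Y `&` Z) =
    homothety c l^-1 @` Y `&` homothety c l^-1 @` Z.
  by rewrite -!preimage_homothety ?gt_eqF.
have li0 : 0 < l^-1 by rewrite invr_gt0.
have hK : X = homothety c l^-1 @` (homothety c l @` X).
  by rewrite image_homothetyK ?gt_eqF.
rewrite preimage_homothety ?gt_eqF// [in LHS]hK.
have -> : ~` (homothety c l^-1 @` A) = homothety c l^-1 @` (~` A).
  by rewrite -!preimage_homothety ?gt_eqF// preimage_setC.
rewrite {2 3}hK -!hI !(@hausdorff_homothety c _ _ li0) -ge0_muleDr ?hausdorff_ge0//.
congr (_ * _)%E; exact: mA.
Qed.

End HausdorffHomothety.

(** * Hausdorff measure of convex hulls *)

Lemma natrS_le_double (R : realType) N : (0 < N)%N -> (N.+1%:R : R) <= 2 * N%:R.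
Proof. by move=> N0; rewrite -natrM ler_nat; lia. Qed.

Section HausdorffHull.
Variables (R : realType) (d m : nat) (x : 'I_m -> 'rV[R]_d).
Implicit Types (S : {set 'I_m}) (delta : R).

Lemma hausdorff_delta_cover (k : nat) (I : finType) (C : I -> set 'rV[R]_d)
    (A : set 'rV[R]_d) delta : 0 <= delta ->
  (forall i, (ediam (C i) <= delta%:E)%E) -> A `<=` \bigcup_i C i ->
  (hausdorff_delta k delta A <=
   (#|I|%:R * (kappa R k * (delta / 2) ^+ k))%:E)%E.
Proof.
move=> delta0 Cd AC.
(* The finite family is padded with empty sets, of weight 0. *)
pose C' i := if insub i is Some j then C (enum_val (j : 'I_#|I|)) else set0.
apply: le_trans (ereal_inf_lbound (x := (\sum_(i <oo) hweight k (C' i))%E) _) _.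
  exists C' => //; split=> [i|y /AC[i _ Ciy]].
    rewrite /C'; case: insub => [j|]; first exact: Cd.
    by rewrite /ediam setX0 image_set0 ereal_sup0 leNye.
  exists (enum_rank i) => //.
  by rewrite /C' valK enum_rankK.
rewrite (nneseries_split _ #|I|); last by move=> *; exact: hweight_ge0.
rewrite [X in (_ + X)%E]eseries0 ?adde0; last first.
  move=> i iI _; rewrite /C' insubF ?hweight0//.
  by apply/negbTE; rewrite -leqNgt; move: iI; rewrite add0n.
rewrite add0n big_mkord.
apply: (@le_trans _ _ (\sum_(i < #|I|) (kappa R k * (delta / 2) ^+ k)%:E)%E).
  apply: lee_sum => i _; rewrite /C' valK.
  rewrite /hweight; case: ifP => [_|/negbT/set0P[y Cy]].
    by rewrite lee_fin mulr_ge0 ?kappa_ge0// exprn_ge0// divr_ge0.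
  rewrite lee_fin ler_wpM2l ?kappa_ge0//.
  rewrite lerXn2r ?nnegrE ?divr_ge0 ?fine_ediam_ge0//.
  rewrite ler_pM2r// -lee_fin fineK//.
  rewrite fin_real//; apply/andP; split.
    by apply: lt_le_trans (ediam_ge Cy Cy); rewrite ltNyr.
  by apply: le_lt_trans (Cd _) _; rewrite ltry.
by rewrite sumEFin sumr_const card_ord mulr_natl.
Qed.

Lemma hull0 : hull x finset.set0 = set0.
Proof.
apply/seteqP; split=> // y [w [_ + _]]; rewrite big_set0 => /eqP.
by rewrite eq_sym oner_eq0.
Qed.

(* Cut hull S along the values of the weights of all but one point, rounded to
   multiples of 1 / N. *)
Lemma hausdorff_delta_hull S (k : nat) : (0 < #|S|)%N ->
  exists2 D : R, 0 <= D & forall N, (0 < N)%N ->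
    (hausdorff_delta k (D / N%:R) (hull x S) <=
     (N.+1%:R ^+ #|S|.-1 * (kappa R k * (D / N%:R / 2) ^+ k))%:E)%E.
Proof.
case/card_gt0P => k0 k0S.
(* With this bound, changing every weight other than that of [k0] by at most 1/N moves the point by
   at most [D / N]. *)
exists (\sum_i \sum_(l in S :\ k0) `|(x l - x k0) 0 i|).
  by apply: sumr_ge0 => i _; apply: sumr_ge0.
set D := \sum_i _; have D0 : 0 <= D by apply: sumr_ge0 => i _; apply: sumr_ge0.
move=> N N0; pose J := #|S :\ k0|.
have JE : J = #|S|.-1 by rewrite /J (cardsD1 k0 S) k0S.
pose cell (c : {ffun 'I_J -> 'I_N.+1}) : set 'rV[R]_d :=
  [set y | exists w : 'I_m -> R, [/\ forall l, 0 <= w l,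
     \sum_(l in S) w l = 1, y = \sum_(l in S) w l *: x l &
     forall i, Num.trunc (N%:R * w (enum_val i)) = c i :> nat]].
have N0' : (0 : R) < N%:R by rewrite ltr0n.
have := @hausdorff_delta_cover k _ cell (hull x S) (D / N%:R).
rewrite card_ffun !card_ord natrX -JE; apply.
- by rewrite divr_ge0.
- move=> c; apply: ediam_le => _ _ [w [w0 w1 -> wc]] [w' [w'0 w'1 -> w'c]].
  apply: le_trans (enorm_le_sum _) _; rewrite mulr_suml; apply: ler_sum => i _.
  (* Both families of weights sum to 1, so the weight of [k0] can be eliminated. *)
  have -> : \sum_(l in S) w l *: x l - \sum_(l in S) w' l *: x l =
      \sum_(l in S :\ k0) (w l - w' l) *: (x l - x k0).
    under [RHS]eq_bigr do rewrite scalerBr; rewrite sumrB -scaler_suml.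
    have -> : \sum_(l in S :\ k0) (w l - w' l) = - (w k0 - w' k0).
      move: w1 w'1; rewrite !(big_setD1 k0 k0S)/= sumrB => + E.
      by rewrite -E; lra.
    rewrite scaleNr opprK -sumrB (big_setD1 k0 k0S)/= addrC; congr (_ + _).
      by apply: eq_bigr => l _; rewrite scalerBl.
    by rewrite scalerBl.
  rewrite summxE mulr_suml; apply: le_trans (ler_norm_sum _ _ _) _.
  apply: ler_sum => l lS; rewrite !mxE normrM mulrC ler_wpM2l//.
  have lJ : l = enum_val (enum_rank_in lS l) by rewrite enum_rankK_in.
  have := wc (enum_rank_in lS l); have := w'c (enum_rank_in lS l).
  rewrite -lJ => <- /eqP E.
  have r0 (v : 'I_m -> R) : (forall l, 0 <= v l) -> 0 <= N%:R * v l.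
    by move=> v0; rewrite mulr_ge0// ltW.
  have := truncn_itv (r0 _ w0); have := truncn_itv (r0 _ w'0).
  rewrite (eqP E) => /andP[a1 a2] /andP[b1 b2].
  rewrite -(ler_pM2l N0') mulfV ?gt_eqF// -[X in X * _](gtr0_norm N0') -normrM.
  rewrite mulrBr; rewrite -natr1 in a2 b2; rewrite ler_norml; apply/andP; split; lra.
- move=> y [w [w0 w1 ->]].
  have w_le1 l : l \in S -> w l <= 1.
    by move=> lS; rewrite -w1 (bigD1 l)//= lerDl sumr_ge0.
  exists [ffun i => inord (Num.trunc (N%:R * w (enum_val i)))] => //.
  exists w; split=> // i; rewrite ffunE inordK// ltnS.
  rewrite -(ler_nat R); apply: (@le_trans _ _ (N%:R * w (enum_val i))).
    by case/andP: (truncn_itv (mulr_ge0 (ltW N0') (w0 (enum_val i)))).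
  rewrite ler_piMr ?(ltW N0')// w_le1//.
  by have := enum_valP i; rewrite !inE => /andP[].
Qed.

(** At mesh [D / N] there are at most (N + 1)^k cells, each of weight of order N^(-k), so the total
    stays bounded as [N] grows. *)
Lemma hausdorff_hull_lty S (k : nat) : (#|S| <= k.+1)%N ->
  (hausdorff k (hull x S) < +oo)%E.
Proof.
move=> Sk; have [S0|S0] := posnP #|S|.
  by move/cards0_eq : S0 => ->; rewrite hull0 hausdorff0.
have [D D0 HD] := hausdorff_delta_hull k S0.
apply: (@le_lt_trans _ _ (kappa R k * D ^+ k)%:E); last by rewrite ltry.
apply: ge_ereal_sup => _ [delta delta0 <-].
pose N := (Num.trunc (D / delta)).+1.
have N0 : (0 : R) < N%:R by rewrite ltr0n.
have DN : D / N%:R <= delta.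
  by rewrite ler_pdivrMr// mulrC -ler_pdivrMr// ltW// truncnS_gt.
apply: le_trans (hausdorff_delta_anti k (hull x S) DN) _.
apply: le_trans (HD N _) _ => //; rewrite lee_fin mulrCA ler_wpM2l ?kappa_ge0//.
apply: (@le_trans _ _ ((2 * N%:R) ^+ k * (D / N%:R / 2) ^+ k)).
  rewrite ler_wpM2r ?exprn_ge0 ?divr_ge0 ?(ltW N0)//.
  have N2 : (N.+1%:R : R) <= 2 * N%:R by exact: natrS_le_double.
  apply: (@le_trans _ _ (N.+1%:R ^+ k)).
    by rewrite ler_weXn2l ?ler1n//; move: Sk; case: #|S|.
  by rewrite lerXn2r ?nnegrE ?mulr_ge0.
rewrite -exprMn (_ : 2 * N%:R * _ = D)//; field.
by rewrite gt_eqF.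
Qed.

(** With one point fewer, the same count leaves a factor 1/N, which tends to 0. *)
Lemma hausdorff_hull_eq0 S (k : nat) : (#|S| <= k)%N ->
  hausdorff k (hull x S) = 0%E.
Proof.
move=> Sk; have [S0|S0] := posnP #|S|.
  by move/cards0_eq : S0 => ->; rewrite hull0 hausdorff0.
have [D D0 HD] := hausdorff_delta_hull k S0.
apply/eqP; rewrite eq_le hausdorff_ge0 andbT.
apply: ge_ereal_sup => _ [delta delta0 <-].
apply/lee_addgt0Pr => e e0; rewrite add0e.
pose K := kappa R k * D ^+ k.
have K0 : 0 <= K by rewrite mulr_ge0 ?kappa_ge0// exprn_ge0.
pose N := (Num.trunc (D / delta + K / e)).+1.
have N0 : (0 : R) < N%:R by rewrite ltr0n.
have NB : D / delta + K / e <= N%:R by rewrite ltW// truncnS_gt.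
have DN : D / N%:R <= delta.
  rewrite ler_pdivrMr// mulrC -ler_pdivrMr// (le_trans _ NB)// lerDl.
  by rewrite divr_ge0// ltW.
have KN : K / N%:R <= e.
  rewrite ler_pdivrMr// mulrC -ler_pdivrMr// (le_trans _ NB)// lerDr.
  by rewrite divr_ge0// ltW.
apply: le_trans (hausdorff_delta_anti k (hull x S) DN) _.
apply: le_trans (HD N _) _ => //; rewrite lee_fin (le_trans _ KN)//.
rewrite mulrCA /K -[leRHS]mulrA ler_wpM2l ?kappa_ge0//.
apply: (@le_trans _ _ ((2 * N%:R) ^+ k / N%:R * (D / N%:R / 2) ^+ k)).
  rewrite ler_wpM2r ?exprn_ge0 ?divr_ge0 ?(ltW N0)//.
  have N2 : (N.+1%:R : R) <= 2 * N%:R by exact: natrS_le_double.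
  have key i j : (0 < j <= i)%N -> (N.+1%:R : R) ^+ j.-1 <= (2 * N%:R) ^+ i / N%:R.
    case: i j => [|i] [|j] // ji; rewrite ler_pdivlMr// exprSr.
    apply: ler_pM; rewrite ?exprn_ge0//.
      apply: (@le_trans _ _ (N.+1%:R ^+ i)); first by rewrite ler_weXn2l ?ler1n.
      by rewrite lerXn2r ?nnegrE ?mulr_ge0.
    by rewrite ler_peMl// ler1n.
  by apply: key; rewrite S0.
rewrite mulrAC -exprMn (_ : 2 * N%:R * _ = D)//; field.
by rewrite gt_eqF.
Qed.

End HausdorffHull.

(** * Barycentric coordinates *)

(** The set is the zero set of the single measurable function [psi], a sum of nonnegative terms. *)
Lemma measurable_ge0_eq0 d (T : measurableType d) (R : realType)
    (I J : finType) (f : I -> T -> R) (g : J -> T -> R) :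
  (forall i, measurable_fun setT (f i)) -> (forall j, measurable_fun setT (g j)) ->
  measurable [set t | (forall i, 0 <= f i t) /\ (forall j, g j t = 0)].
Proof.
move=> mf mg.
pose psi t := \sum_i (`|f i t| - f i t) + \sum_j `|g j t|.
have mpsi : measurable_fun setT psi.
  apply: measurable_funD; apply: measurable_sum => i; last exact: measurableT_comp.
  by apply: measurable_funB => //; exact: measurableT_comp.
rewrite (_ : [set t | _] = psi @^-1` [set 0]).
  by rewrite -[X in measurable X]setTI; exact: mpsi.
have n0 t : 0 <= \sum_i (`|f i t| - f i t).
  by apply: sumr_ge0 => i _; rewrite subr_ge0 ler_norm.
apply/seteqP; split=> t.
  move=> [f0 g0]; rewrite /= /psi !big1 ?addr0// => i _; first by rewrite g0 normr0.
  by rewrite ger0_norm ?subrr.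
move=> /eqP; rewrite paddr_eq0 ?n0 ?sumr_ge0// => /andP[/eqP e1 /eqP e2]; split=> i.
  have /eqP : `|f i t| - f i t = 0.
    by apply: (psumr_eq0P _ e1) => // j _; rewrite subr_ge0 ler_norm.
  by rewrite subr_eq0 => /eqP <-.
by apply: normr0_eq0; apply: (psumr_eq0P _ e2).
Qed.

Section AffineFunctions.
Variables (R : realType) (d : nat).
Implicit Types (phi : 'rV[R]_d -> R) (y z : 'rV[R]_d).

Definition affine_fun phi : Prop :=
  exists c (w : 'rV[R]_d), forall y, phi y = c + dot w y.

Lemma affine_fun_cst (c : R) : affine_fun (fun=> c).
Proof.
exists c, 0 => y; rewrite /dot big1 ?addr0// => i _.
by rewrite mxE mul0r.
Qed.

Lemma affine_fun_coord i : affine_fun (fun y => y 0 i).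
Proof.
exists 0, (delta_mx 0 i) => y; rewrite add0r /dot (bigD1 i)//= big1.
  by rewrite !mxE !eqxx mul1r addr0.
by move=> j ji; rewrite mxE (negbTE ji) andbF mul0r.
Qed.

Lemma affine_funZ (a : R) phi : affine_fun phi -> affine_fun (fun y => a * phi y).
Proof.
move=> [c [w E]]; exists (a * c), (a *: w) => y; rewrite E mulrDr; congr (_ + _).
by rewrite /dot mulr_sumr; apply: eq_bigr => i _; rewrite mxE mulrA.
Qed.

Lemma affine_funD phi psi : affine_fun phi -> affine_fun psi ->
  affine_fun (fun y => phi y + psi y).
Proof.
move=> [c [w E]] [c' [w' E']]; exists (c + c'), (w + w') => y.
rewrite E E' addrACA; congr (_ + _); rewrite /dot -big_split/=.
by apply: eq_bigr => i _; rewrite mxE mulrDl.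
Qed.

Lemma affine_fun_sum (I : Type) (s : seq I) (P : pred I)
    (phi : I -> 'rV[R]_d -> R) : (forall i, affine_fun (phi i)) ->
  affine_fun (fun y => \sum_(i <- s | P i) phi i y).
Proof.
move=> aphi; elim: s => [|i s IHs].
  by under eq_fun do rewrite big_nil; exact: affine_fun_cst.
under eq_fun do rewrite big_cons; case: (P i) => //.
exact: affine_funD.
Qed.

Lemma affine_fun_homothety phi v l y : affine_fun phi ->
  phi (homothety v l y) = phi v + l * (phi y - phi v).
Proof.
move=> [c [w E]]; rewrite !E /dot.
have -> : \sum_i w 0 i * homothety v l y 0 i =
    \sum_i w 0 i * v 0 i +
    l * (\sum_i w 0 i * y 0 i - \sum_i w 0 i * v 0 i).
  rewrite -sumrB mulr_sumr -big_split/=; apply: eq_bigr => i _.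
  by rewrite !mxE; ring.
ring.
Qed.

Lemma affine_fun_comb (I : finType) (P : {pred I}) (w : I -> R)
    (v : I -> 'rV[R]_d) phi :
  affine_fun phi -> \sum_(i in P) w i = 1 ->
  phi (\sum_(i in P) w i *: v i) = \sum_(i in P) w i * phi (v i).
Proof.
move=> [c [u E]] w1; rewrite E.
under [RHS]eq_bigr do rewrite E mulrDr.
rewrite big_split/= -mulr_suml w1 mul1r; congr (_ + _).
rewrite /dot; under [LHS]eq_bigr do rewrite summxE mulr_sumr.
rewrite exchange_big/=; apply: eq_bigr => i _; rewrite mulr_sumr.
by apply: eq_bigr => j _; rewrite mxE; ring.
Qed.

Lemma affine_fun_lipschitz phi : affine_fun phi ->
  exists L, forall y z, `|phi y - phi z| <= L * enorm (y - z).
Proof.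
move=> [c [w E]]; exists (\sum_i `|w 0 i|) => y z.
rewrite !E opprD addrACA subrr add0r /dot -sumrB mulr_suml.
apply: le_trans (ler_norm_sum _ _ _) _; apply: ler_sum => i _.
rewrite -mulrBr normrM ler_wpM2l//.
by have := ler_coord_enorm (y - z) i; rewrite !mxE.
Qed.

Lemma measurable_affine_fun (k : nat) phi : affine_fun phi ->
  measurable_fun [set: caratheodory_type (@hausdorff R d k)] phi.
Proof.
by move=> /affine_fun_lipschitz[L]; exact: measurable_fun_lipschitz.
Qed.

End AffineFunctions.

(** * Barycentric coordinates of a simplex *)

Section Barycentric.
Variables (R : realType) (d m : nat) (x : 'I_m -> 'rV[R]_d).
Implicit Types (S : {set 'I_m}).

(** When [S] spans a proper affine subspace, these are its barycentric coordinates together with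
    some affine extension to the whole space. *)
Definition barycentric S (b : 'I_m -> 'rV[R]_d -> R) : Prop :=
  (forall l, affine_fun (b l)) /\
  {in S &, forall l j, b l (x j) = (l == j)%:R}.

(** Affine independence makes the rows (1, x_k) with k in [S] linearly independent; the columns of a
    right inverse hold the coefficients of the coordinate functions. *)
Lemma aff_indep_barycentric S : aff_indep x S -> exists b, barycentric S b.
Proof.
rewrite /aff_indep /arank; set M := \matrix_l _ => rkM.
pose A := rowsub (enum_val : 'I_#|S| -> 'I_m) M.
have /row_freeP[B AB] : row_free A.
  rewrite /row_free eqn_leq rank_leq_row -[leqLHS]rkM mxrankS//.
  apply/row_subP => l; rewrite rowK; case: ifPn => [lS|_]; last exact: sub0mx.
  have -> : row_mx 1%:M (x l) = row (enum_rank_in lS l) A.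
    by rewrite row_rowsub enum_rankK_in// rowK lS.
  exact: row_sub.
(* The indicator selects the column that belongs to [l], and yields 0 for [l] outside [S]. *)
pose b (l : 'I_m) (y : 'rV[R]_d) :=
  \sum_(i < #|S|) (enum_val i == l)%:R * (row_mx 1%:M y *m B) 0 i.
exists b; split.
  move=> l; apply: affine_fun_sum => i; apply: affine_funZ.
  rewrite -[B]vsubmxK; exists (usubmx B 0 i), (\row_j dsubmx B j i) => y.
  rewrite mul_row_col mul1mx [LHS]mxE; congr (_ + _).
  by rewrite mxE /dot; apply: eq_bigr => j _; rewrite [in RHS]mxE mulrC.
move=> l j lS jS; rewrite /b.
have -> : row_mx 1%:M (x j) = row (enum_rank_in jS j) A.
  by rewrite row_rowsub enum_rankK_in// rowK jS.
rewrite -row_mul AB (bigD1 (enum_rank_in lS l))//= big1 => [|i il].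
  rewrite enum_rankK_in// eqxx mul1r addr0 !mxE; congr (nat_of_bool _)%:R.
  rewrite eq_sym; apply/eqP/eqP => [|lj].
    by move=> /(congr1 enum_val); rewrite !enum_rankK_in.
  by apply: enum_val_inj; rewrite !enum_rankK_in.
rewrite (_ : enum_val i == l = false) ?mul0r//; apply/negbTE.
by apply: contraNneq il => il; apply/eqP/enum_val_inj; rewrite il enum_rankK_in.
Qed.

Variables (S : {set 'I_m}) (b : 'I_m -> 'rV[R]_d -> R).
Hypothesis bS : barycentric S b.

Lemma barycentric_comb w l : l \in S -> \sum_(j in S) w j = 1 ->
  b l (\sum_(j in S) w j *: x j) = w l.
Proof.
move=> lS w1; rewrite (affine_fun_comb _ (bS.1 l) w1) (bigD1 l)//=.
rewrite bS.2// eqxx mulr1 big1 ?addr0// => j /andP[jS jl].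
by rewrite bS.2// eq_sym (negbTE jl) mulr0.
Qed.

Lemma hull_barycentricP y : hull x S y <->
  [/\ forall l, l \in S -> 0 <= b l y, \sum_(l in S) b l y = 1 &
      y = \sum_(l in S) b l y *: x l].
Proof.
split=> [[w [w0 w1 ->]]|[b0 b1 yE]].
  have bw l : l \in S -> b l (\sum_(j in S) w j *: x j) = w l.
    by move=> lS; exact: barycentric_comb.
  split.
  - by move=> l lS; rewrite bw.
  - by rewrite -[RHS]w1; apply: eq_bigr.
  - by apply: eq_bigr => l lS; rewrite bw.
exists (fun l => if l \in S then b l y else 0); split.
- by move=> l; case: ifP => // /b0.
- by rewrite -b1; apply: eq_bigr => l ->.
- by rewrite {1}yE; apply: eq_bigr => l ->.
Qed.

(** A simplex is cut out by finitely many affine inequalities and equations. In [g], [None] encodes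
    that the coordinates sum to 1, and [Some i] that they reproduce the [i]-th entry of the
    point. *)
Lemma measurable_hull (k : nat) :
  measurable (hull x S : set (caratheodory_type (@hausdorff R d k))).
Proof.
pose f l y := if l \in S then b l y else 0.
pose g (j : option 'I_d) (y : 'rV[R]_d) := if j is Some i
  then y 0 i + (-1) * \sum_(l in S) x l 0 i * b l y else \sum_(l in S) b l y + (-1).
have af l : affine_fun (f l).
  by rewrite /f; case: (l \in S); [exact: bS.1|exact: affine_fun_cst].
have ag j : affine_fun (g j).
  case: j => [i|].
    apply: affine_funD; first exact: affine_fun_coord.
    by apply/affine_funZ/affine_fun_sum => l; exact/affine_funZ/bS.1.
  apply: affine_funD; last exact: affine_fun_cst.
  by apply: affine_fun_sum; exact: bS.1.
have := measurable_ge0_eq0 (fun l => @measurable_affine_fun _ _ k _ (af l))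
  (fun j => @measurable_affine_fun _ _ k _ (ag j)).
congr (measurable _); apply/seteqP; split=> y.
  move=> [f0 g0]; apply/hull_barycentricP; split.
  - by move=> l lS; have := f0 l; rewrite /f lS.
  - by have /eqP := g0 None; rewrite /g subr_eq0 => /eqP.
  - apply/rowP => i; have /eqP := g0 (Some i); rewrite /g mulN1r subr_eq0 => /eqP ->.
    by rewrite summxE; apply: eq_bigr => l _; rewrite mxE mulrC.
move=> /hull_barycentricP[b0 b1 yE]; split=> [l|[i|]].
- by rewrite /f; case: ifP => // /b0.
- rewrite /g {1}yE summxE mulN1r; apply/eqP; rewrite subr_eq0; apply/eqP.
  by apply: eq_bigr => l _; rewrite mxE mulrC.
- by rewrite /g b1 subrr.
Qed.

Lemma homothety_hull_sub j l : j \in S -> 0 <= l <= 1 ->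
  homothety (x j) l @` hull x S `<=` hull x S.
Proof.
move=> jS /andP[l0 l1] _ [y [w [w0 w1 ->]] <-].
exists (fun i => l * w i + (1 - l) * (i == j)%:R); split.
- by move=> i; rewrite addr_ge0// mulr_ge0// subr_ge0.
- rewrite big_split/= -!mulr_sumr w1 (bigD1 j)//= eqxx big1 ?addr0.
    by rewrite mulr1 /= mulr1 addrC subrK.
  by move=> i /andP[_ /negbTE ->].
under [RHS]eq_bigr do rewrite scalerDl -!scalerA.
rewrite big_split/= -!scaler_sumr.
have -> : \sum_(i in S) ((i == j)%:R : R) *: x i = x j.
  rewrite (bigD1 j)//= eqxx scale1r big1 ?addr0// => i /andP[_ /negbTE ->].
  by rewrite scale0r.
by rewrite /homothety scalerBr scalerBl scale1r addrC -addrA; congr (_ + _); rewrite addrC.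
Qed.

(** Shrinking towards [x j] uncovers only a layer along the opposite face: if [b j y > 1 - l], the
    inverse homothety keeps all coordinates of [y] nonnegative. *)
Lemma hullD_homothety j l y : j \in S -> 0 < l ->
  hull x S y -> ~ (homothety (x j) l @` hull x S) y -> b j y <= 1 - l.
Proof.
move=> jS l0 /hull_barycentricP[b0 b1 yE]; apply: contra_notP => /negP.
rewrite -ltNge => /ltW lb; exists (homothety (x j) l^-1 y); last first.
  by rewrite homothetyVK ?gt_eqF.
have bh i : i \in S -> b i (homothety (x j) l^-1 y) =
    (i == j)%:R + l^-1 * (b i y - (i == j)%:R).
  by move=> iS; rewrite (affine_fun_homothety _ _ _ (bS.1 i)) bS.2.
have d1 : \sum_(i in S) ((i == j)%:R : R) = 1.
  rewrite (bigD1 j)//= eqxx big1 ?addr0// => i /andP[_ /negbTE ->] //.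
apply/hull_barycentricP; split.
- move=> i iS; rewrite bh//; have [->|ij] := eqVneq i j; last first.
    by rewrite add0r subr0 mulr_ge0 ?invr_ge0 ?(ltW l0)// b0.
  by rewrite -(pmulr_rge0 _ l0) mulrDr mulrA mulfV ?gt_eqF//= !(mulr1, mul1r); lra.
- rewrite (eq_bigr _ bh) big_split/= d1 -mulr_sumr sumrB b1 d1; ring.
- rewrite (eq_bigr _ (fun i iS => congr1 (fun c => c *: x i) (bh i iS))).
  have dx : \sum_(i in S) ((i == j)%:R : R) *: x i = x j.
    rewrite (bigD1 j)//= eqxx scale1r big1 ?addr0// => i /andP[_ /negbTE ->].
    by rewrite scale0r.
  under eq_bigr do rewrite scalerDl -scalerA scalerBl.
  by rewrite big_split/= -scaler_sumr sumrB dx -yE.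
Qed.

End Barycentric.

(** * Differentiating a scaling law *)

Lemma Rintegral_mscale d (T : measurableType d) (R : realType)
    (mu : {measure set T -> \bar R}) (c : {nonneg R}) (D : set T) (f : T -> R) :
  measurable D -> mu.-integrable D (EFin \o f) ->
  \int[mscale c mu]_(t in D) f t = c%:num * \int[mu]_(t in D) f t.
Proof.
move=> mD intf; have mf := measurable_int mu intf.
rewrite /Rintegral integralE.
rewrite (ge0_integral_mscale _ mD)//; last exact: measurable_funepos.
rewrite (ge0_integral_mscale _ mD)//; last exact: measurable_funeneg.
have p := integrable_fin_num mD (integrable_funepos mD intf).
have q := integrable_fin_num mD (integrable_funeneg mD intf).
rewrite fineB ?fin_numM// !fineM// -mulrBr; congr (_ * _).
by rewrite -fineB// -integralE.
Qed.

(** The last hypothesis says that [mu] is [c] times its pushforward under [h], so this is a change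
    of variables. *)
Lemma Rintegral_scaling d (T : measurableType d) (R : realType)
    (mu : {measure set T -> \bar R}) (c : {nonneg R}) (h : T -> T) (B : set T)
    (f : T -> R) :
  measurable_fun setT h -> measurable B -> measurable_fun setT f ->
  mu.-integrable (h @^-1` B) (EFin \o (f \o h)) ->
  (forall A, measurable A -> mu A = ((c%:num)%:E * mu (h @^-1` A))%E) ->
  \int[mu]_(t in B) f t = c%:num * \int[mu]_(t in h @^-1` B) f (h t).
Proof.
move=> mh mB /measurable_EFinP mf intf muh.
pose nu0 := (pushforward mu h : {measure set T -> \bar R}).
pose nu := nu0 mh.
have intnu : nu.-integrable B (EFin \o f) by exact: integrable_pushforward.
have -> : \int[mu]_(t in B) f t = \int[mscale c nu]_(t in B) f t.
  rewrite /Rintegral; congr fine; apply: eq_measure_integral => A mA _.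
  exact: muh.
rewrite Rintegral_mscale//; congr (_ * _); rewrite /Rintegral; congr fine.
exact: integral_pushforward.
Qed.

Lemma eq0_ler_eps (R : realType) (z K : R) :
  (forall e, 0 < e < 1 -> `|z| <= e * K) -> z = 0.
Proof.
move=> zK; apply/eqP; rewrite -normr_eq0 eq_le normr_ge0 andbT.
apply/ler_addgt0Pr => e e0; rewrite add0r.
pose M := `|K| + e + 1.
have M0 : 0 < M by rewrite /M; have := normr_ge0 K; lra.
apply: le_trans (zK (e / M) _) _.
  rewrite divr_gt0//= ltr_pdivrMr// mul1r /M; have := normr_ge0 K; lra.
rewrite mulrAC ler_pdivrMr// ler_pM2l// /M; have := ler_norm K; lra.
Qed.

Lemma expr1B_quadratic (R : realType) n : exists2 Q : R, 0 <= Q &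
  forall e : R, 0 <= e <= 1 -> `|(1 - e) ^+ n - 1 + n%:R * e| <= Q * e ^+ 2.
Proof.
elim: n => [|n [Q Q0 IHn]].
  by exists 0 => // e _; rewrite expr0 subrr mul0r addr0 normr0 mul0r.
exists (Q + n%:R); first by rewrite addr_ge0.
move=> e /andP[e0 e1]; have := IHn e; rewrite e0 e1 => /(_ isT) He.
have -> : (1 - e) ^+ n.+1 - 1 + n.+1%:R * e =
    (1 - e) * ((1 - e) ^+ n - 1 + n%:R * e) + n%:R * e ^+ 2.
  by rewrite exprS -natr1; ring.
apply: le_trans (ler_normD _ _) _; rewrite [leRHS]mulrDl lerD//.
  rewrite normrM ger0_norm ?subr_ge0// (le_trans _ He)// ler_piMl//; lra.
by rewrite ger0_norm// mulr_ge0// exprn_ge0.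
Qed.

(** * Integrals of uniformly bounded one-parameter families *)

Section BoundedFamilies.
Context d (T : measurableType d) (R : realType).
Variables (mu : {measure set T -> \bar R}) (D : set T).
Implicit Types (f g : R -> T -> R).

(** The bound is uniform in the parameter, so that an integrated remainder stays bounded as [e]
    tends to 0. A single function enters as a constant family. *)
Definition nice f : Prop := (forall e, measurable_fun setT (f e)) /\
  exists C, forall e t, 0 <= e <= 1 -> D t -> `|f e t| <= C.

Lemma nice_cst c : nice (fun=> fun=> c).
Proof. by split=> [e|]; [exact: measurable_cst|exists `|c|]. Qed.

Lemma nice_param : nice (fun e => fun=> e).
Proof.
split=> [e|]; first exact: measurable_cst.
by exists 1 => e _ /andP[e0 e1] _; rewrite ger0_norm.
Qed.

Lemma niceD f g : nice f -> nice g -> nice (fun e t => f e t + g e t).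
Proof.
move=> [mf [C fC]] [mg [C' gC']]; split=> [e|]; first exact: measurable_funD.
exists (C + C') => e t e01 Dt.
by rewrite (le_trans (ler_normD _ _))// lerD ?fC ?gC'.
Qed.

Lemma niceM f g : nice f -> nice g -> nice (fun e t => f e t * g e t).
Proof.
move=> [mf [C fC]] [mg [C' gC']]; split=> [e|]; first exact: measurable_funM.
exists (C * C') => e t e01 Dt.
by rewrite normrM ler_pM ?fC ?gC'.
Qed.

Lemma nice_sum I (s : seq I) (P : pred I) (f : I -> R -> T -> R) :
  (forall i, nice (f i)) -> nice (fun e t => \sum_(i <- s | P i) f i e t).
Proof.
move=> nf; elim: s => [|i s IHs].
  by under eq_fun do under eq_fun do rewrite big_nil; exact: nice_cst.
under eq_fun do under eq_fun do rewrite big_cons; case: (P i) => //.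
exact: niceD.
Qed.

Hypothesis mD : measurable D.
Hypothesis muD : (mu D < +oo)%E.

Lemma nice_integrable f e : nice f -> 0 <= e <= 1 ->
  mu.-integrable D (EFin \o f e).
Proof.
move=> [mf [C fC]] e01; apply: measurable_bounded_integrable => //.
  exact: measurable_funTS.
exists C; split; first exact: num_real.
by move=> C' CC' t Dt /=; rewrite (le_trans (fC _ _ e01 Dt))// ltW.
Qed.

Lemma nice_integral_le f : nice f ->
  exists C, forall e, 0 <= e <= 1 -> `|\int[mu]_(t in D) f e t| <= C.
Proof.
move=> nf; have [_ [C fC]] := nf; exists (C * fine (mu D)) => e e01.
have intf := nice_integrable nf e01.
apply: le_trans (le_normr_Rintegral mD intf) _.
rewrite -Rintegral_cst//; apply: le_Rintegral => //.
- exact: integrable_norm.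
- by apply: (nice_integrable (e := 0) (nice_cst C)); rewrite lexx ler01.
- by move=> t; exact: fC.
Qed.

(* Differentiates the scaling law of the integral over h_e(D) at e = 0; the
   integral over the complement of h_e(D) in D is negligible since f is small
   there. *)
Lemma scaling_derivative (n : nat) (h : R -> T -> T) (b f u : T -> R)
    (rho : R -> T -> R) :
  (forall e, 0 < e < 1 -> [/\ measurable_fun setT (h e), measurable (h e @` D),
    h e @` D `<=` D & h e @^-1` (h e @` D) = D]) ->
  (forall e A, 0 < e < 1 -> measurable A ->
    mu A = (((1 - e) ^+ n)%:E * mu (h e @^-1` A))%E) ->
  (forall e t, 0 < e < 1 -> D t -> ~ (h e @` D) t -> 0 <= b t <= e) ->
  nice (fun=> f) -> nice (fun=> u) -> nice rho ->
  (exists C, forall t, D t -> `|f t| <= C * `|b t|) ->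
  (forall e t, 0 < e < 1 -> D t ->
    f (h e t) = f t + e * u t + e ^+ 2 * rho e t) ->
  n%:R * \int[mu]_(t in D) f t = \int[mu]_(t in D) u t.
Proof.
move=> hD muh bh nf nu nrho [C fC] fh.
set If := \int[mu]_(t in D) f t; set Iu := \int[mu]_(t in D) u t.
have [K rhoK] := nice_integral_le nrho.
have [Q Q0 HQ] := expr1B_quadratic R n.
have z01 : 0 <= (0 : R) <= 1 by rewrite lexx ler01.
have intf : mu.-integrable D (EFin \o f) := nice_integrable nf z01.
have intu : mu.-integrable D (EFin \o u) := nice_integrable nu z01.
pose V := fine (mu D).
have V0 : 0 <= V by exact: fine_ge0.
(* Change of variables along [h e], then the expansion of [f (h e t)]. *)
have scaled e : 0 < e < 1 -> \int[mu]_(t in h e @` D) f t =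
    (1 - e) ^+ n * (If + e * Iu + e ^+ 2 * \int[mu]_(t in D) rho e t).
  move=> e01; have [mh mhD hDD hK] := hD e e01.
  have /andP[e0 e1] := e01; have e01' : 0 <= e <= 1 by rewrite !ltW.
  have le0 : 0 <= (1 - e) ^+ n by rewrite exprn_ge0// subr_ge0 ltW.
  have nfh : mu.-integrable D (EFin \o (fun t => f t + e * u t + e ^+ 2 * rho e t)).
    apply: (nice_integrable (f := fun e t => f t + e * u t + e ^+ 2 * rho e t)) => //.
    apply: niceD; first by apply: niceD => //; exact: niceM nice_param nu.
    by apply: niceM => //; apply: (niceM nice_param nice_param).
  have intfh : mu.-integrable (h e @^-1` (h e @` D)) (EFin \o (f \o h e)).
    rewrite hK; apply: eq_integrable nfh => // t /set_mem Dt /=.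
    by rewrite fh.
  rewrite (Rintegral_scaling (c := NngNum le0) mh mhD (nf.1 0) intfh); last first.
    by move=> A; exact: muh.
  rewrite /= hK; congr (_ * _).
  transitivity (\int[mu]_(t in D) (f t + e * u t + e ^+ 2 * rho e t)).
    by apply: eq_Rintegral => t /set_mem Dt /=; rewrite fh.
  have iu : mu.-integrable D (EFin \o (fun t => e * u t)).
    exact: (nice_integrable (niceM nice_param nu) e01').
  rewrite RintegralD//; first last.
  - exact: (nice_integrable (niceM (niceM nice_param nice_param) nrho) e01').
  - exact: (nice_integrable (niceD nf (niceM nice_param nu)) e01').
  rewrite RintegralD// !RintegralZl//.
  exact: (nice_integrable nrho e01').
have hvol e : 0 < e < 1 -> fine (mu (h e @` D)) = (1 - e) ^+ n * V.
  move=> e01; have [mh mhD hDD hK] := hD e e01.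
  by rewrite (muh _ _ e01 mhD) hK fineM// ge0_fin_numE.
(* On the removed part [f] is at most [|C| * e] in absolute value, and the measure of that part is
   itself O(e): the contribution is of second order. *)
have rest e : 0 < e < 1 ->
    `|If - \int[mu]_(t in h e @` D) f t| <= `|C| * e * (V - (1 - e) ^+ n * V).
  move=> e01; have [mh mhD hDD hK] := hD e e01; have /andP[e0 e1] := e01.
  have mDh : measurable (D `\` h e @` D) by exact: measurableD.
  have sDh : D `\` h e @` D `<=` D by exact: subDsetl.
  have -> : If - \int[mu]_(t in h e @` D) f t = \int[mu]_(t in D `\` h e @` D) f t.
    rewrite /If -{1}(setDUK hDD) Rintegral_setU//; first by rewrite addrC addKr.
      by rewrite setDUK.
    by apply/eqP/seteqP; split=> // t [? []].
  have intDh : mu.-integrable (D `\` h e @` D) (EFin \o f).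
    exact: integrableS intf.
  have volDh : fine (mu (D `\` h e @` D)) = V - (1 - e) ^+ n * V.
    rewrite -(hvol e e01) measureD// (setIidr hDD) fineB// ge0_fin_numE//.
    exact: le_lt_trans (le_measure mu (mem_set mhD) (mem_set mD) hDD) muD.
  apply: le_trans (le_normr_Rintegral mDh intDh) _.
  rewrite -volDh -Rintegral_cst//; apply: le_Rintegral => //.
  - exact: integrable_norm.
  - apply: measurable_bounded_integrable => //.
      exact: le_lt_trans (le_measure mu (mem_set mDh) (mem_set mD) sDh) muD.
    exists (`|C| * e); split=> [|M CM t _]; first exact: num_real.
    by rewrite ger0_norm ?(ltW CM)// mulr_ge0// ltW.
  move=> t [Dt nht]; have /andP[b0 be] := bh e t e01 Dt nht.
  apply: le_trans (fC t Dt) _; rewrite (ger0_norm b0).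
  apply: (@le_trans _ _ (`|C| * b t)); first by rewrite ler_wpM2r// ler_norm.
  by rewrite ler_wpM2l.
apply/eqP; rewrite -subr_eq0; apply/eqP; set z := _ - _.
(* Chosen so that the errors in the expansion of [e * z] add up to at most [e ^+ 2 * K']. *)
pose K' := `|C| * V * (n%:R + Q) + Q * `|If| + (n%:R + Q) * `|Iu| + K.
apply: (@eq0_ler_eps _ _ K') => e e01; have /andP[e0 e1] := e01.
have e01' : 0 <= e <= 1 by rewrite !ltW.
have := HQ e e01'; set q := _ + n%:R * e => qQ.
have lE : (1 - e) ^+ n = 1 - (n%:R * e - q) by rewrite /q; ring.
have l01 : 0 <= (1 - e) ^+ n <= 1.
  have le0 : 0 <= 1 - e by lra.
  by rewrite exprn_ge0// exprn_ile1//; lra.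
have dle : `|n%:R * e - q| <= (n%:R + Q) * e.
  apply: le_trans (ler_normB _ _) _; rewrite mulrDl lerD//.
    by rewrite ger0_norm// mulr_ge0// ltW.
  by apply: le_trans qQ _; rewrite ler_wpM2l// expr2 ler_piMl// ltW.
rewrite -(ler_pM2l e0) -{1}(gtr0_norm e0) -normrM.
have -> : e * z = (If - \int[mu]_(t in h e @` D) f t) + q * If +
    (- ((n%:R * e - q) * e * Iu)) +
    (1 - e) ^+ n * (e ^+ 2 * \int[mu]_(t in D) rho e t).
  by rewrite scaled// lE /z; ring.
have -> : e * (e * K') = `|C| * e * (((n%:R + Q) * e) * V) + Q * e ^+ 2 * `|If| +
   ((n%:R + Q) * e) * e * `|Iu| + e ^+ 2 * K by rewrite /K'; ring.
apply: le_trans (ler_normD _ _) _; apply: lerD; last first.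
  rewrite normrM mulrC -[leRHS]mulr1 ler_pM//; last first.
    by case/andP: l01 => l0 l1; rewrite ger0_norm.
  by rewrite normrM ger0_norm ?sqr_ge0// ler_wpM2l ?sqr_ge0// rhoK.
apply: le_trans (ler_normD _ _) _; apply: lerD; last first.
  by rewrite normrN !normrM (gtr0_norm e0) ler_wpM2r// ler_wpM2r// ltW.
apply: le_trans (ler_normD _ _) _; apply: lerD; last first.
  by rewrite normrM ler_wpM2r.
apply: le_trans (rest e e01) _; rewrite ler_wpM2l ?mulr_ge0 ?(ltW e0)//.
rewrite -[X in X - _]mul1r -mulrBl ler_wpM2r//.
by rewrite (le_trans _ dle)// lE subKr ler_norm.
Qed.

End BoundedFamilies.

Section QuadraticRemainder.
Variable A : comNzRingType.

(** Second-order remainder of (a + e c)^r in e. The recursion uses ring operations only, so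
    measurability and boundedness pass from the arguments to the remainder. *)
Fixpoint expr_rem (a c e : A) (r : nat) : A :=
  if r is r'.+1 then
    (a + e * c) * expr_rem a c e r' + r'%:R * a ^+ r'.-1 * c ^+ 2
  else 0.

Lemma exprD_quadratic (a c e : A) r : (a + e * c) ^+ r =
  a ^+ r + e * (r%:R * a ^+ r.-1 * c) + e ^+ 2 * expr_rem a c e r.
Proof.
elim: r => [|r IHr]; first by rewrite !expr0 /= mul0r mul0r !mulr0 !addr0.
rewrite exprS IHr /= -natr1; case: r {IHr} => [|r] /=.
  by rewrite !expr0; ring.
by rewrite !exprS; ring.
Qed.

End QuadraticRemainder.

(** * Coefficientwise integration of polynomial-valued functions *)

Section PolynomialIntegrals.
Context d (T : measurableType d) (R : realType) (nv : nat).
Variables (mu : {measure set T -> \bar R}) (D : set T).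
Hypothesis mD : measurable D.
Hypothesis muD : (mu D < +oo)%E.
Implicit Types (g : R -> T -> mpoly nv R) (a : multinom nv).

Definition nicep g : Prop := forall a, nice D (fun e t => mcoeff a (g e t)).

Lemma nicep_cst p : nicep (fun=> fun=> p).
Proof. by move=> a; exact: nice_cst. Qed.

Lemma nicep_mpolyC (f : R -> T -> R) :
  nice D f -> nicep (fun e t => mpolyC nv (f e t)).
Proof.
move=> nf a; under eq_fun do under eq_fun do rewrite mcoeffC.
exact: niceM nf (nice_cst _ _).
Qed.

Lemma nicepD g g' : nicep g -> nicep g' -> nicep (fun e t => g e t + g' e t).
Proof.
move=> ng ng' a; under eq_fun do under eq_fun do rewrite mcoeffD.
exact: niceD.
Qed.

Lemma nicepM g g' : nicep g -> nicep g' -> nicep (fun e t => g e t * g' e t).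
Proof.
move=> ng ng' a; under eq_fun do under eq_fun do rewrite mcoeffM.
by apply: nice_sum => k; exact: niceM.
Qed.

Lemma nicepX g r : nicep g -> nicep (fun e t => g e t ^+ r).
Proof.
move=> ng; elim: r => [|r IHr]; first exact: nicep_cst.
by under eq_fun do under eq_fun do rewrite exprS; exact: nicepM.
Qed.

Lemma nicep_expr_rem (x y z : R -> T -> mpoly nv R) r :
  nicep x -> nicep y -> nicep z ->
  nicep (fun e t => expr_rem (x e t) (y e t) (z e t) r).
Proof.
move=> nx ny nz; elim: r => [|r IHr] /=; first exact: nicep_cst.
apply: nicepD; last exact: nicepM (nicepM (nicep_cst _) (nicepX _ nx)) (nicepX _ ny).
exact: nicepM (nicepD nx (nicepM nz ny)) IHr.
Qed.

Definition polyint (g : T -> mpoly nv R) a : R :=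
  \int[mu]_(t in D) mcoeff a (g t).

Let z01 : 0 <= (0 : R) <= 1. Proof. by rewrite lexx ler01. Qed.

Lemma eq_polyint (g g' : T -> mpoly nv R) a :
  (forall t, D t -> g t = g' t) -> polyint g a = polyint g' a.
Proof. by move=> gg'; apply: eq_Rintegral => t /set_mem Dt; rewrite gg'. Qed.

Lemma polyintD (g g' : T -> mpoly nv R) a :
  nicep (fun=> g) -> nicep (fun=> g') ->
  polyint (fun t => g t + g' t) a = polyint g a + polyint g' a.
Proof.
move=> ng ng'; rewrite /polyint -RintegralD//.
- by apply: eq_Rintegral => t _; rewrite mcoeffD.
- exact: (nice_integrable mD muD (ng a) z01).
- exact: (nice_integrable mD muD (ng' a) z01).
Qed.

Lemma polyint_sum I (s : seq I) (P : pred I) (g : I -> T -> mpoly nv R) a :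
  (forall i, nicep (fun=> g i)) ->
  polyint (fun t => \sum_(i <- s | P i) g i t) a =
  \sum_(i <- s | P i) polyint (g i) a.
Proof.
move=> ng; have nsum s' : nicep (fun=> fun t => \sum_(i <- s' | P i) g i t).
  elim: s' => [|i s' IHs].
    by under eq_fun do under eq_fun do rewrite big_nil; exact: nicep_cst.
  under eq_fun do under eq_fun do rewrite big_cons; case: (P i) => //.
  exact: nicepD.
elim: s => [|i s IHs].
  rewrite big_nil /polyint; under eq_Rintegral do rewrite big_nil mcoeff0.
  by rewrite Rintegral_cst// mul0r.
rewrite big_cons; transitivity
    (polyint (fun t => (if P i then g i t else 0) + \sum_(j <- s | P j) g j t) a).
  by apply: eq_polyint => t _; rewrite big_cons; case: (P i); rewrite ?add0r.
case: (P i); first by rewrite polyintD ?IHs.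
by rewrite -IHs; apply: eq_polyint => t _; rewrite add0r.
Qed.

Lemma polyintMr (g : T -> mpoly nv R) p a : nicep (fun=> g) ->
  polyint (fun t => g t * p) a =
  \sum_(k : bmultinom nv (mdeg a).+1 * bmultinom nv (mdeg a).+1 |
        a == mnm_add k.1 k.2) polyint g k.1 * mcoeff k.2 p.
Proof.
move=> ng; rewrite {1}/polyint.
(* Each summand is stored as a constant polynomial, so that [polyint_sum] applies to the constant
   coefficient. *)
transitivity (\int[mu]_(t in D)
  mcoeff (@mnm0 nv) (\sum_(k : bmultinom nv (mdeg a).+1 * bmultinom nv (mdeg a).+1 |
    a == mnm_add k.1 k.2) mpolyC nv (mcoeff k.1 (g t) * mcoeff k.2 p))).
  apply: eq_Rintegral => t _; rewrite mcoeffM raddf_sum/=.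
  by apply: eq_bigr => k _; rewrite mcoeffC eqxx mulr1.
rewrite -/(polyint _ _) polyint_sum; last first.
  move=> k; apply: (nicep_mpolyC (f := fun=> fun t => _)).
  exact: niceM (ng _) (nice_cst _ _).
apply: eq_bigr => k _; rewrite /polyint -RintegralZr//; last first.
  exact: (nice_integrable mD muD (ng k.1) z01).
by apply: eq_Rintegral => t _; rewrite mcoeffC eqxx mulr1.
Qed.

Lemma polyintZ (c : R) (g : T -> mpoly nv R) a : nicep (fun=> g) ->
  polyint (fun t => mpolyC nv c * g t) a = c * polyint g a.
Proof.
move=> ng; rewrite /polyint -RintegralZl//; last first.
  exact: (nice_integrable mD muD (ng a) z01).
by apply: eq_Rintegral => t _; rewrite mcoeffCM.
Qed.

End PolynomialIntegrals.

(** * Moments of a simplex *)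

(** The binomial coefficient of [n + r] over [n]. For n = d - 1 it is (r+d-1)!/(d-1)! combined with
    the 1/r! of the surface tensor. *)
Definition moment_const (R : realType) (n r : nat) : R :=
  (n + r)`!%:R / (n`!%:R * r`!%:R).

(** * Moment generating function of a set that can be shrunk towards each of n + 1 vertices *)

Section SelfSimilarMoments.
Context d (T : measurableType d) (R : realType) (nv n m : nat).
Variables (mu : {measure set T -> \bar R}) (D : set T).
Variables (S : {set 'I_m}) (h : 'I_m -> R -> T -> T) (b : 'I_m -> T -> R).
Variables (X : 'I_m -> mpoly nv R) (l : T -> mpoly nv R).
Hypothesis mD : measurable D.
Hypothesis muD : (mu D < +oo)%E.
Hypothesis hD : forall k e, k \in S -> 0 < e < 1 ->
  [/\ measurable_fun setT (h k e), measurable (h k e @` D),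
      h k e @` D `<=` D & h k e @^-1` (h k e @` D) = D].
Hypothesis muh : forall k e A, k \in S -> 0 < e < 1 -> measurable A ->
  mu A = (((1 - e) ^+ n)%:E * mu (h k e @^-1` A))%E.
Hypothesis bh : forall k e t, k \in S -> 0 < e < 1 -> D t ->
  ~ (h k e @` D) t -> 0 <= b k t <= e.
Hypothesis nice_b : forall k, nice D (fun=> b k).
Hypothesis nicep_l : nicep D (fun=> l).
Hypothesis b_h : forall k e t, k \in S -> b k (h k e t) = b k t + e * (1 - b k t).
Hypothesis l_h : forall k e t, k \in S ->
  l (h k e t) = l t + mpolyC nv e * (X k - l t).
Hypothesis sum_b : forall t, D t -> \sum_(k in S) b k t = 1.
Hypothesis card_S : #|S| = n.+1.
Hypothesis X0 : forall k, mcoeff (@mnm0 nv) (X k) = 0.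
Hypothesis X_euler : forall k, is_euler (X k) (X k).

Local Notation P := (polyint mu D).
Local Notation C := (mpolyC nv).

Let z01 : 0 <= (0 : R) <= 1. Proof. by rewrite lexx ler01. Qed.

Let nicep_b k : nicep D (fun=> fun t => C (b k t)).
Proof. exact: (nicep_mpolyC (f := fun=> b k)). Qed.

Let nicep_lX r : nicep D (fun=> fun t => l t ^+ r).
Proof. exact: (nicepX (g := fun=> l)). Qed.

Let nicep_bl k r : nicep D (fun=> fun t => C (b k t) * l t ^+ r).
Proof. exact: (nicepM (nicep_b k) (nicep_lX r)). Qed.

(** This is [scaling_derivative] for b_k l^r: the factor b_k makes the integrand small near the
    opposite face, and the right-hand integrand is the first-order term along [h k e]. *)
Lemma moment_derivative k r (a : multinom nv) : k \in S ->
  n%:R * P (fun t => C (b k t) * l t ^+ r) a =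
  P (fun t => (1 - C (b k t)) * l t ^+ r +
              C (b k t) * (r%:R * l t ^+ r.-1 * (X k - l t))) a.
Proof.
move=> kS.
pose L1 t := r%:R * l t ^+ r.-1 * (X k - l t).
have n1b : nicep D (fun=> fun t => 1 - C (b k t)).
  have -> : (fun t => 1 - C (b k t)) = (fun t => 1 + C (-1) * C (b k t)).
    by apply/funext => t; rewrite rmorphN1 mulN1r.
  exact: (nicepD (nicep_cst _ _) (nicepM (nicep_cst _ _) (nicep_b k))).
have nXl : nicep D (fun=> fun t => X k - l t).
  have -> : (fun t => X k - l t) = (fun t => X k + C (-1) * l t).
    by apply/funext => t; rewrite rmorphN1 mulN1r.
  exact: (nicepD (nicep_cst _ _) (nicepM (nicep_cst _ _) nicep_l)).
have nL1 : nicep D (fun=> L1).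
  exact: (nicepM (nicepM (nicep_cst _ _) (nicep_lX _)) nXl).
(* What remains, after division by e^2, of the product of the expansions of [b k] and [l ^+ r]. *)
pose rho e t := (1 - C (b k t)) * L1 t +
  (C (b k t) + C e * (1 - C (b k t))) * expr_rem (l t) (X k - l t) (C e) r.
have nC : nicep D (fun (e : R) (_ : T) => C e).
  have nn : nice D (fun (e : R) (_ : T) => e) by exact: nice_param.
 exact (nicep_mpolyC nn).
have nrho : nicep D rho.
  apply: nicepD; first exact: nicepM n1b nL1.
  apply: nicepM; last exact: (nicep_expr_rem r nicep_l nXl nC).
  exact: (nicepD (nicep_b k) (nicepM nC n1b)).
apply: (@scaling_derivative _ T R mu D mD muD n (h k) (b k)
  (fun t => mcoeff a (C (b k t) * l t ^+ r)) _ (fun e t => mcoeff a (rho e t))).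
- by move=> e; exact: hD.
- by move=> e A; exact: muh.
- by move=> e t; exact: bh.
- exact: (nicep_bl k r a).
- exact: (nicepD (nicepM n1b (nicep_lX r)) (nicepM (nicep_b k) nL1) a).
- exact: (nrho a).
- have [_ [K lK]] := nicep_lX r a; exists K => t Dt.
  by rewrite mcoeffCM normrM mulrC ler_wpM2r// (lK 0).
move=> e t e01 Dt; rewrite b_h// l_h// exprD_quadratic rmorphD rmorphM rmorphB rmorph1.
rewrite -[e * mcoeff _ _]mcoeffCM -[e ^+ 2 * _]mcoeffCM -!mcoeffD rmorphXn.
by congr (mcoeff a _); rewrite /rho /L1; ring.
Qed.

(** Collecting the terms in b_k l^r on the left raises the factor n to n + 1 + r. *)
Lemma moment_recursion k r (a : multinom nv) : k \in S ->
  (n.+1 + r)%:R * P (fun t => C (b k t) * l t ^+ r) a =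
  P (fun t => l t ^+ r) a +
  r%:R * P (fun t => C (b k t) * l t ^+ r.-1 * X k) a.
Proof.
move=> kS; rewrite -addn1 -addnA natrD mulrDl moment_derivative//.
have nX : nicep D (fun=> fun t => C (b k t) * l t ^+ r.-1 * X k).
  exact: (nicepM (nicep_bl k r.-1) (nicep_cst _ _)).
rewrite -!polyintZ// -!polyintD//; first last.
- exact: (nicepM (nicep_cst _ _) nX).
- exact: (nicepM (nicep_cst _ _) (nicep_bl k r)).
- apply: (nicepD (g := fun=> fun t => (1 - C (b k t)) * l t ^+ r)).
    have -> : (fun t => (1 - C (b k t)) * l t ^+ r) =
        (fun t => l t ^+ r + C (-1) * (C (b k t) * l t ^+ r)).
      by apply/funext => t; rewrite rmorphN1; ring.
    exact: (nicepD (nicep_lX r) (nicepM (nicep_cst _ _) (nicep_bl k r))).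
  have -> : (fun t => C (b k t) * (r%:R * l t ^+ r.-1 * (X k - l t))) =
      (fun t => C r%:R * (C (b k t) * l t ^+ r.-1 * X k) +
                C (- r%:R) * (C (b k t) * l t ^+ r.-1 * l t)).
    by apply/funext => t; rewrite rmorphN rmorph_nat; ring.
  apply: (nicepD (nicepM (nicep_cst _ _) nX) (nicepM (nicep_cst _ _) _)).
  exact: (nicepM (nicep_bl k r.-1) nicep_l).
apply: eq_polyint => t _; rewrite natrD rmorphD rmorph_nat rmorph1.
case: r {nX} => [|r] /=; first by ring.
by rewrite exprS; ring.
Qed.

Lemma sum_moment r (a : multinom nv) :
  \sum_(k in S) P (fun t => C (b k t) * l t ^+ r) a = P (fun t => l t ^+ r) a.
Proof.
rewrite -polyint_sum//; apply: eq_polyint => t Dt.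
by rewrite -mulr_suml -rmorph_sum/= sum_b// rmorph1 mul1r.
Qed.

Local Notation c := (moment_const R n).

Let c_rec r : r.+1%:R * c r.+1 = (n.+1 + r)%:R * c r.
Proof.
rewrite /moment_const addnS !factS !natrM -addSn; field.
by rewrite nat1r !pnatr_eq0 -!lt0n !fact_gt0.
Qed.

Lemma moment_generating_function (a : multinom nv) :
  c (mdeg a) * P (fun t => l t ^+ mdeg a) a =
  fps_frac (C (fine (mu D))) (\prod_(k in S) (1 - X k)) a.
Proof.
pose N := (mdeg a).+1.
(* Truncation below degree [N]. The polynomials [A] and [B k] truncate the series a and a_k; their
   coefficient at [u] uses the moment of order [mdeg u]. *)
pose cut (E : multinom nv -> R) := \sum_(u : bmultinom nv N) (E u *: mpolyX R u).
have cutE E u : mcoeff u (cut E) = if (mdeg u < N)%N then E u else 0.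
  case: ifPn => uN; first exact: mcoeff_mpoly.
  rewrite /cut raddf_sum/= big1// => v _; rewrite mcoeffZ mcoeffX.
  case: eqP => [vu|_]; last by rewrite mulr0.
  by move: uN; rewrite -vu bmdeg.
pose A := cut (fun u => c (mdeg u) * P (fun t => l t ^+ mdeg u) u).
pose B k := cut (fun u => (n.+1 + mdeg u)%:R * c (mdeg u) *
  P (fun t => C (b k t) * l t ^+ mdeg u) u).
have BA k : k \in enum S -> vanish_below N (B k * (1 - X k) - A).
  rewrite mem_enum => kS u uN.
  have BX : mcoeff u (B k * X k) = (mdeg u)%:R * c (mdeg u) *
      P (fun t => C (b k t) * l t ^+ (mdeg u).-1 * X k) u.
    rewrite polyintMr// mcoeffM mulr_sumr; apply: eq_bigr => -[/= v w] /eqP uvw.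
    have uE : mdeg u = (mdeg v + mdeg w)%N by rewrite [in LHS]uvw mdegD.
    (* As [X k] is homogeneous of degree 1, only [w] of degree 1 contributes, and [v] has degree one
       less than [u]; [c_rec] then matches the constants. *)
    have [w1|w1] := eqVneq (mdeg w) 1%N; last first.
      suff -> : mcoeff w (X k) = 0 by rewrite !mulr0.
      have /eqP := X_euler k w; rewrite -subr_eq0 -[X in X - _]mul1r -mulrBl.
      rewrite mulf_eq0 subr_eq0 eq_sym (eqr_nat R _ 1) (negbTE w1)/=.
      by move/eqP.
    have uS : mdeg u = (mdeg v).+1 by apply: (etrans uE); rewrite w1 addn1.
    rewrite cutE ifT; last by rewrite -ltnS -uS ltnW.
    have uv i : i = (mdeg v).+1 ->
        i%:R * c i = (n.+1 + mdeg v)%:R * c (mdeg v) by move=> ->; exact: c_rec.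
    have uP : (mdeg u).-1 = mdeg v by apply: (etrans (congr1 predn uS)).
    by rewrite (uv _ uS) uP mulrA.
  rewrite mcoeffB mulrBr mulr1 mcoeffB BX /B /A !cutE uN.
  rewrite [_ * c _]mulrC -!mulrA moment_recursion//.
  by rewrite mulrDr; ring.
(* Because the [b k] sum to 1, the sum of the [B k] carries the factor n + 1 + |u|; removing n + 1
   copies of [A] leaves the Euler factor |u|. *)
have Aeuler : is_euler A (\sum_(k <- enum S) B k - (size (enum S))%:R * A).
  move=> u; rewrite -cardE card_S mcoeffB mulr_natl mcoeffMn raddf_sum/=.
  rewrite /A cutE.
  under eq_bigr do rewrite /B cutE; case: ifPn => uN; last first.
    by rewrite big1// mul0rn subr0 mulr0.
  rewrite -[X in _ - X]mulr_natl -mulr_sumr big_enum sum_moment natrD; ring.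
have := prod1B_log_derivative X0 X_euler BA Aeuler.
rewrite big_enum/= => AX.
have A0 : mcoeff (@mnm0 nv) A = fine (mu D).
  rewrite /A cutE mdeg0 /= /moment_const addn0 fact0 mulr1 divff ?pnatr_eq0 -?lt0n ?fact_gt0//.
  rewrite mul1r /polyint; under eq_Rintegral do rewrite expr0 mcoeff1 eqxx.
  by rewrite Rintegral_cst// mul1r.
rewrite -A0; transitivity (mcoeff a A); first by rewrite /A cutE ltnSn.
apply/esym/fps_frac_eq; last by rewrite mulrC.
rewrite rmorph_prod/= big1// => k _.
by rewrite mcoeffB mcoeff1 eqxx X0 subr0.
Qed.

End SelfSimilarMoments.

(** * Facets *)

Section LinearForms.
Variables (R : realType) (d : nat).
Implicit Types (y z v : 'rV[R]_d) (a : multinom d).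

Lemma linform_homothety v (e : R) y : linform (homothety v (1 - e) y) =
  linform y + mpolyC d e * (linform v - linform y).
Proof.
rewrite /linform -sumrB mulr_sumr -big_split/=; apply: eq_bigr => i _.
by rewrite !mxE mul_mpolyC -scalerBl scalerA -scalerDl; congr (_ *: _); ring.
Qed.

Lemma mcoeff_linform y a :
  mcoeff a (linform y) = \sum_(i < d) mcoeff a (mpolyX R (mnm1 i)) * y 0 i.
Proof.
by rewrite /linform raddf_sum/=; apply: eq_bigr => i _; rewrite mcoeffZ mulrC.
Qed.

Lemma mcoeff_linform_eq0 y a : mdeg a != 1%N -> mcoeff a (linform y) = 0.
Proof.
move=> a1; rewrite mcoeff_linform big1// => i _; rewrite mcoeffX.
by case: eqP => [ia|_]; rewrite ?mul0r//; rewrite -ia mdeg1 eqxx in a1.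
Qed.

Lemma mcoeff0_linform y : mcoeff (@mnm0 d) (linform y) = 0.
Proof. by rewrite mcoeff_linform_eq0// mdeg0. Qed.

Lemma is_euler_linform y : is_euler (linform y) (linform y).
Proof.
move=> a; have [->|a1] := eqVneq (mdeg a) 1%N; first by rewrite mul1r.
by rewrite mcoeff_linform_eq0// mulr0.
Qed.

Lemma mcoeff_linformX_eq0 y r a : mdeg a != r -> mcoeff a (linform y ^+ r) = 0.
Proof.
elim: r a => [|r IHr] a ar.
  by rewrite expr0 mcoeff1 -mdeg_eq0 (negbTE ar).
rewrite exprS mcoeffM big1// => -[/= u v] /eqP auv.
have aE : mdeg a = (mdeg u + mdeg v)%N by rewrite [in LHS]auv mdegD.
have [u1|u1] := eqVneq (mdeg u) 1%N; last by rewrite mcoeff_linform_eq0// mul0r.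
rewrite IHr ?mulr0//; apply: contra_neq ar => vr.
by apply: (etrans aE); rewrite u1 vr.
Qed.

Lemma mcoeff0_prod_Lpoly m (x : 'I_m -> 'rV[R]_d) (P : pred 'I_m) :
  mcoeff (@mnm0 d) (\prod_(k | P k) Lpoly x k) = 1.
Proof.
rewrite rmorph_prod/= big1// => k _.
by rewrite mcoeffB mcoeff1 eqxx mcoeff0_linform subr0.
Qed.

End LinearForms.

(** * Moments of geometric simplices *)

Section HullMoments.
Variables (R : realType) (d m n : nat) (x : 'I_m -> 'rV[R]_d).
Implicit Types (S F : {set 'I_m}) (phi : 'rV[R]_d -> R).
Local Notation cT := (caratheodory_type (@hausdorff R d n)).
Local Notation mu := (hausdorff_measure R d n).

Lemma nice_affine_fun S phi : affine_fun phi ->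
  @nice _ cT R (hull x S) (fun=> phi).
Proof.
move=> aphi; split=> [_|]; first exact: measurable_affine_fun.
exists (\sum_(k in S) `|phi (x k)|) => _ y _ [w [w0 w1 ->]].
rewrite affine_fun_comb// (le_trans (ler_norm_sum _ _ _))//.
apply: ler_sum => k kS; rewrite normrM ler_piMl// ger0_norm//.
by rewrite -w1 (bigD1 k)//= lerDl sumr_ge0.
Qed.

Lemma nicep_linform S : @nicep _ cT R d (hull x S) (fun=> @linform R d).
Proof.
move=> a; under eq_fun do under eq_fun do rewrite mcoeff_linform.
apply: nice_affine_fun; apply: affine_fun_sum => i.
exact/affine_funZ/affine_fun_coord.
Qed.

(** The abstract setting is realised by the homotheties with centre [x k] and ratio [1 - e], the
    barycentric coordinates, and [linform]. *)
Lemma simplex_moments S a : aff_indep x S -> #|S| = n.+1 ->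
  moment_const R n (mdeg a) *
    \int[mu]_(y in hull x S) mcoeff a (linform y ^+ mdeg a) =
  fps_frac (mpolyC d (fine (hausdorff n (hull x S)))) (\prod_(k in S) Lpoly x k) a.
Proof.
move=> /aff_indep_barycentric[b bS] cardS.
have mH : measurable (hull x S : set cT) by exact: measurable_hull bS n.
have Hlty : (hausdorff n (hull x S) < +oo)%E.
  by apply: hausdorff_hull_lty; rewrite cardS.
have lt01 (e : R) : 0 < e < 1 -> 0 < 1 - e by case/andP => _; rewrite subr_gt0.
apply: (@moment_generating_function _ cT R d n m mu (hull x S) S
  (fun k e => homothety (x k) (1 - e)) b (fun k => linform (x k)) (@linform R d)).
- exact: mH.
- exact: Hlty.
- move=> k e kS e01; have l0 := lt01 e e01; split.
  + exact: measurable_homothety.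
  + have l0' : 0 < (1 - e)^-1 by rewrite invr_gt0.
    have := measurable_homothety (x k) l0' measurableT mH.
    by rewrite setTI preimage_homothety ?gt_eqF// invrK.
  + apply: homothety_hull_sub => //; case/andP: e01 => e0 e1.
    by rewrite (ltW l0) gerBl ltW.
  + by rewrite preimage_homothety ?image_homothetyK ?gt_eqF.
- move=> k e A kS e01 mA; have l0 := lt01 e e01.
  rewrite -[LHS]/(hausdorff n A) -[mu (_ @^-1` _)]/(hausdorff n (_ @^-1` _)).
  rewrite -(@hausdorff_homothety R d n (x k))//; congr hausdorff.
  rewrite preimage_homothety ?gt_eqF// -{2}(invrK (1 - e)) image_homothetyK//.
  by rewrite gt_eqF// invr_gt0.
- move=> k e y kS e01 Hy nHy; apply/andP; split.
    by case/(hull_barycentricP bS): Hy => b0 _ _; exact: b0.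
  by have := hullD_homothety bS kS (lt01 e e01) Hy nHy; rewrite subKr.
- by move=> k; apply: nice_affine_fun; exact: bS.1.
- exact: nicep_linform.
- move=> k e y kS; rewrite (affine_fun_homothety _ _ _ (bS.1 k)) bS.2// eqxx.
  by rewrite /=; ring.
- by move=> k e y kS; exact: linform_homothety.
- by move=> y /(hull_barycentricP bS)[].
- exact: cardS.
- by move=> k; exact: mcoeff0_linform.
- by move=> k; exact: is_euler_linform.
Qed.

End HullMoments.

(** * Integration over almost disjoint unions *)

Lemma Rintegral_almost_disjointU d (T : measurableType d) (R : realType)
    (mu : {measure set T -> \bar R}) (A B : set T) (f : T -> R) :
  measurable A -> measurable B -> mu (A `&` B) = 0%E ->
  mu.-integrable (A `|` B) (EFin \o f) ->
  \int[mu]_(t in A `|` B) f t = \int[mu]_(t in A) f t + \int[mu]_(t in B) f t.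
Proof.
move=> mA mB AB0 intf.
have intB : mu.-integrable B (EFin \o f).
  exact: (integrableS (measurableU _ _ mA mB) mB (@subsetUr _ _ _) intf).
(* Replacing [B] by its part outside [A] makes the union disjoint and loses only a null set. *)
have E : A `|` (B `\` A) = A `|` B. by rewrite setUDr setDv setD0.
rewrite -[in LHS]E Rintegral_setU//.
- congr (_ + _); rewrite [RHS]/Rintegral (negligible_integral (N := A `&` B))//.
    by rewrite !setDE setCI setIUr setICr setU0.
  exact: measurableI.
- exact: measurableD.
- by rewrite E.
- by apply/eqP; exact: setDIK.
Qed.

Lemma measurable_bigsetU_seq d (T : measurableType d) (I : eqType) (s : seq I)
    (A : I -> set T) : (forall i, i \in s -> measurable (A i)) ->
  measurable (\big[setU/set0]_(i <- s) A i).
Proof. by move=> mA; rewrite big_seq; exact: bigsetU_measurable. Qed.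

Lemma Rintegral_almost_disjoint d (T : measurableType d) (R : realType)
    (mu : {measure set T -> \bar R}) (I : eqType) (s : seq I) (A : I -> set T)
    (f : T -> R) : uniq s ->
  (forall i, i \in s -> measurable (A i)) ->
  {in s &, forall i j, i != j -> mu (A i `&` A j) = 0%E} ->
  mu.-integrable (\big[setU/set0]_(i <- s) A i) (EFin \o f) ->
  \int[mu]_(t in \big[setU/set0]_(i <- s) A i) f t =
  \sum_(i <- s) \int[mu]_(t in A i) f t.
Proof.
elim: s => [|i s IHs]; first by rewrite !big_nil Rintegral_set0.
rewrite /= => /andP[is_ us] mA Aij; rewrite !big_cons => intf.
have mAi : measurable (A i) by apply: mA; rewrite mem_head.
have mAs j : j \in s -> measurable (A j).
  by move=> js; apply: mA; rewrite inE js orbT.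
have mB := measurable_bigsetU_seq mAs.
rewrite Rintegral_almost_disjointU//.
  rewrite IHs// => [j k js ks|]; first by apply: Aij; rewrite inE ?js ?ks orbT.
  exact: (integrableS (measurableU _ _ mAi mB) mB (@subsetUr _ _ _) intf).
have AB0 : forall j, j \in s -> mu (A i `&` A j) = 0%E.
  move=> j js; apply: Aij; rewrite ?inE ?eqxx ?js ?orbT//.
  by apply: contraNneq is_ => ->.
elim: {IHs us is_ Aij mA intf mB} s mAs AB0 => [|j s IHs] mAs AB0.
  by rewrite big_nil setI0 measure0.
have sub k : k \in s -> k \in j :: s by move=> ks; rewrite inE ks orbT.
rewrite big_cons setIUr measureU0.
- by apply: AB0; rewrite mem_head.
- by apply: measurableI => //; apply: mAs; rewrite mem_head.
- by apply: measurableI => //; apply: measurable_bigsetU_seq => k /sub; exact: mAs.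
- by apply: IHs => k /sub; [exact: mAs|exact: AB0].
Qed.

(** * Moments of a triangulated facet *)

Section TriangulatedFacet.
Variables (R : realType) (n m : nat) (x : 'I_m -> 'rV[R]_n.+1).
Variables (F : {set 'I_m}) (T : {set {set 'I_m}}).
Hypothesis tF : is_triangulation x F T.
Hypothesis rF : arank x F = n.+1.
Local Notation cT := (caratheodory_type (@hausdorff R n.+1 n)).
Local Notation mu := (hausdorff_measure R n.+1 n).

Let T_indep S : S \in T -> aff_indep x S.
Proof. by case: tF => _ + _ _ => /[apply] -[]. Qed.

Let T_card S : S \in T -> #|S| = n.+1.
Proof. by case: tF => _ + _ _ => /[apply] -[<- ->]. Qed.

Let T_sub S : S \in T -> S \subset F.
Proof.
case: tF => vT _ _ _ ST; apply/fintype.subsetP => k kS.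
have [G [[a [c [_ ->]]] + _]] := vT S k ST kS.
by rewrite inE => /andP[].
Qed.

Let mhull S : S \in T -> measurable (hull x S : set cT).
Proof.
by move=> /T_indep/aff_indep_barycentric[b bS]; exact: measurable_hull bS n.
Qed.

Let hullF : hull x F = \big[setU/set0]_(S <- enum T) hull x S.
Proof.
case: tF => _ _ -> _; rewrite -bigcup_seq; congr bigcup.
by apply/seteqP; split=> S /=; rewrite mem_enum.
Qed.

Let mF : measurable (hull x F : set cT).
Proof.
rewrite hullF; apply: (@measurable_bigsetU_seq _ cT) => S.
by rewrite mem_enum; exact: mhull.
Qed.

Let Slty S : S \in T -> (hausdorff n (hull x S) < +oo)%E.
Proof. by move=> ST; apply: hausdorff_hull_lty; rewrite T_card. Qed.

Let Flty : (hausdorff n (hull x F) < +oo)%E.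
Proof.
rewrite hullF; have : forall S, S \in enum T -> (hausdorff n (hull x S) < +oo)%E.
  by move=> S; rewrite mem_enum; exact: Slty.
elim: (enum T) => [|S s IHs] sT; first by rewrite big_nil hausdorff0.
rewrite big_cons; apply: le_lt_trans (outer_measureU2 _ _ _) _.
rewrite lte_add_pinfty// ?sT ?mem_head// IHs// => S' S's.
by rewrite sT// inE S's orbT.
Qed.

(** Distinct simplices of the triangulation have n + 1 points each, so they meet in the hull of at
    most n points, which is a null set. *)
Let T_disjoint : {in enum T &, forall S S',
  S != S' -> hausdorff n (hull x S `&` hull x S') = 0%E}.
Proof.
move=> S S'; rewrite !mem_enum => ST S'T SS'.
case: tF => _ _ _ ->//; apply: hausdorff_hull_eq0.
rewrite -ltnS -(T_card ST) proper_card// properE finset.subsetIl/=.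
apply: contra SS' => SI; rewrite eqEcard (T_card ST) (T_card S'T) leqnn andbT.
exact: fintype.subset_trans SI (finset.subsetIr _ _).
Qed.

Lemma Rintegral_facet (f : cT -> R) : @nice _ cT R (hull x F) (fun=> f) ->
  \int[mu]_(y in hull x F) f y = \sum_(S in T) \int[mu]_(y in hull x S) f y.
Proof.
move=> nf; have intf : mu.-integrable (hull x F) (EFin \o f).
  apply: (@nice_integrable _ cT R mu _ mF Flty _ 0 nf).
  by rewrite lexx ler01.
rewrite hullF in intf *; rewrite (@Rintegral_almost_disjoint _ cT)//.
- by rewrite big_enum.
- exact: enum_uniq.
- by move=> S; rewrite mem_enum; exact: mhull.
Qed.

Let vol_scaled S : S \in T -> vol x F * (vol x S / vol x F) = vol x S.
Proof.
(* If [vol x F] is 0, the quotient is 0 by convention, and monotonicity forces [vol x S] to be 0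
   too. *)
move=> ST; have [F0|F0] := eqVneq (vol x F) 0; last by rewrite mulrC divfK.
rewrite F0 mul0r; apply/esym/eqP; rewrite eq_le -{1}F0 fine_ge0 ?hausdorff_ge0//.
have fS : hausdorff n (hull x S) \is a fin_num.
  by rewrite ge0_fin_numE ?hausdorff_ge0 ?Slty.
have fF : hausdorff n (hull x F) \is a fin_num.
  by rewrite ge0_fin_numE ?hausdorff_ge0 ?Flty.
rewrite andbT; apply: (fine_le fS fF).
apply: le_hausdorff; case: tF => _ _ -> _ y Sy.
by exists S.
Qed.

(** Each simplex S of the triangulation contributes its volume over the product of the [Lpoly x k]
    with k in S; expanding by the factors with k in F but not in S gives the common denominator and
    the adjoint. *)
Lemma facet_moments (a : multinom n.+1) :
  moment_const R n (mdeg a) *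
    \int[mu]_(y in hull x F) mcoeff a (linform y ^+ mdeg a) =
  fps_frac (vol x F *: adjoint_poly x T F) (\prod_(k in F) Lpoly x k) a.
Proof.
have nl := nicepX (mdeg a) (nicep_linform n x F) a.
rewrite (Rintegral_facet nl).
rewrite mulr_sumr /adjoint_poly scaler_sumr fps_frac_sum.
apply: eq_bigr => S ST; rewrite simplex_moments ?T_card//; last exact: T_indep.
have -> : \prod_(k in F) Lpoly x k =
    \prod_(k in S) Lpoly x k * \prod_(k in F :\: S) Lpoly x k.
  by rewrite (big_setID S)/= (finset.setIidPr (T_sub ST)).
by rewrite scalerA vol_scaled// -mul_mpolyC fps_fracMr ?mcoeff0_prod_Lpoly.
Qed.

End TriangulatedFacet.

Theorem theorem4p3 (R : realType) (d m s : nat) (x : 'I_m -> 'rV[R]_d)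
    (T : {set 'I_m} -> {set {set 'I_m}}) :
  (0 < d)%N ->
  arank x [set: 'I_m]%SET = d.+1 ->
  (forall F : {set 'I_m}, facet x F -> is_simplicial x F) ->
  (forall F : {set 'I_m}, facet x F -> is_triangulation x F (T F)) ->
  let sum_over_facets : fps d (tensor R d s) := fun a =>
    (s`!%:R * omega R (1 + s))^-1 *:
      \sum_(F : {set 'I_m} | facet x F)
        fps_frac_tensor
          (poly_tensor (vol x F *: adjoint_poly x (T F) F)
             (tensor_pow s (outer_normal x F)))
          (\prod_(k in F) Lpoly x k) a in
  let single_fraction : fps d (tensor R d s) := fun a =>
    (s`!%:R * omega R (1 + s))^-1 *:
      fps_frac_tensor
        (\sum_(F : {set 'I_m} | facet x F)
           poly_tensor
             (vol x F *: adjoint_poly x (T F) F * \prod_(k | k \notin F) Lpoly x k)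
             (tensor_pow s (outer_normal x F)))
        (\prod_(k < m) Lpoly x k) a in
  fps_sums
    (fun r a => ((r + d - 1)`!%:R / (d - 1)`!%:R) *: Minkowski_poly x r s a)
    sum_over_facets
  /\ sum_over_facets = single_fraction.
Proof.
case: d x => // n x _ rk _ tF sum_over_facets single_fraction; split.
  (* Since (y . t)^r is homogeneous of degree r, only the term r = |a| contributes to the
     coefficient of t^a. *)
  move=> a; exists (mdeg a).+1 => M aM; rewrite (bigD1 (Ordinal aM))//=.
  rewrite [X in _ + X]big1 ?addr0 => [|r ra]; last first.
    rewrite /Minkowski_poly big1 ?scaler0// => F _.
    rewrite [X in X *: _](_ : _ = 0) ?scale0r//.
    under eq_Rintegral do rewrite mcoeff_linformX_eq0 1?eq_sym//.
    by rewrite /Rintegral integral0.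
  rewrite /Minkowski_poly /sum_over_facets; apply/ffunP => J.
  rewrite !ffunE !sum_ffunE !scaler_sumr; apply: eq_bigr => F facF.
  (* The rank is one more than the affine dimension, so a facet in dimension n + 1 has rank n +
     1. *)
  have rF : arank x F = n.+1.
    by move: facF => /asboolP[_]; rewrite rk => -[].
  rewrite !ffunE fps_fracZ -(facet_moments (tF F facF) rF).
  rewrite /moment_const addnS !subn1 /= [(mdeg a + n)%N]addnC -!mulrA invfM /=.
  rewrite /GRing.scale/= [in RHS]invfM.
  by rewrite !invfM; ring.
apply/funext => a; rewrite /sum_over_facets /single_fraction; congr (_ *: _).
apply/ffunP => J; rewrite !ffunE !sum_ffunE fps_frac_sum; apply: eq_bigr => F _.
rewrite !ffunE [LHS]fps_fracZ [RHS]fps_fracZ.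
(* Each facet term is expanded by the factors of the vertices outside [F]. *)
have -> : \prod_(k < m) Lpoly x k =
    \prod_(k in F) Lpoly x k * \prod_(k | k \notin F) Lpoly x k.
  exact: (bigID (mem F)).
by rewrite fps_fracMr ?mcoeff0_prod_Lpoly.
Qed.
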